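(* Let $r$ be a positive natural number. Let the functions $f,g:\mathbb{H}^2\to\mathbb{C}$ be holomorphic and let $P:\mathbb{R}\to\mathbb{C}$ be a complex-valued polynomial $$P(t)=\sum_{k=0}^{2r-1}b_kt^k$$ such that $(b_{2r-2},b_{2r-1})\neq 0$. Then the function $$F(z,t)=(f(z)+g(\bar z))\cdot P(t)$$ is proper $r$-harmonic on the product space $\mathbb{H}^2\times\mathbb{R}$.
   Context: $\mathbb{H}^2$ is the hyperbolic disc $\{z\in\mathbb{C}: |z|<1\}$ with its standard Riemannian metric of constant curvature $-1$, and $\mathbb{H}^2\times\mathbb{R}$ carries the product metric with the standard metric $dt^2$ on $\mathbb{R}$. Let $\tau$ be the Laplace-Beltrami operator of this product metric, acting on smooth complex-valued functions. Put $\tau^0(F)=F$ and $\tau^r(F)=\tau(\tau^{r-1}(F))$. For $r\ge1$, a smooth function $F$ is $r$-harmonic if $\tau^r(F)=0$ identically, and proper $r$-harmonic if $\tau^r(F)=0$ and $\tau^{r-1}(F)$ does not vanish identically.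
   Formalization: The formal statement additionally assumes that f(z)+g(z̄) is not identically zero on the disc; otherwise (e.g. f=g=0) F vanishes identically and is not proper r-harmonic. *)

(* Defs.v *)
(* The analysis (derivatives, continuity, complex numbers) is Coquelicot's, on
   the real numbers of the standard library; the matrices of metric
   coefficients are MathComp's, through the ring structure of Rstruct.
   The ring operations on R of either library are convertible. *)
From Stdlib Require Import Reals.
From mathcomp Require Import all_boot all_algebra.
From mathcomp Require Import Rstruct.
From Coquelicot Require Import Coquelicot.

Set Implicit Arguments.
Unset Strict Implicit.
Unset Printing Implicit Defensive.

Import GRing.Theory.
Local Open Scope ring_scope.

Definition H2 (z : C) : Prop := Rlt (Cmod z) 1.

(* Functions on H^2 x R are total functions on C * R, of which only the values
   at the points of H2xR matter: H2xR is open, so that the derivatives at its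
   points do not depend on the values outside of it. *)
Definition H2xR (p : C * R) : Prop := H2 p.1.

Definition holomorphic_on_disc (f : C -> C) : Prop :=
  forall z : C, H2 z -> @ex_derive C_AbsRing C_NormedModule f z.

(* The global coordinates of (x + iy, t) are x, y, t, numbered 0, 1, 2. *)
Definition shift (i : 'I_3) (p : C * R) (h : R) : C * R :=
  let: ((x, y), t) := p in
  match nat_of_ord i with
  | 0%N => ((x + h, y), t)
  | 1%N => ((x, y + h), t)
  | _ => ((x, y), t + h)
  end.

Definition partial (i : 'I_3) (u : C * R -> R) (p : C * R) : R :=
  Derive (fun h => u (shift i p h)) 0.

Definition ex_partial (i : 'I_3) (u : C * R -> R) (p : C * R) : Prop :=
  ex_derive (fun h => u (shift i p h)) 0.

Definition iter_partial (s : seq 'I_3) (u : C * R -> R) : C * R -> R :=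
  foldr partial u s.

(* C^oo: all the iterated partial derivatives exist and are continuous. *)
Definition smooth_real (u : C * R -> R) : Prop :=
  forall (s : seq 'I_3) (p : C * R), H2xR p ->
    continuous (iter_partial s u) p /\
    forall i : 'I_3, ex_partial i (iter_partial s u) p.

Definition smooth (F : C * R -> C) : Prop :=
  smooth_real (fun p => Re (F p)) /\ smooth_real (fun p => Im (F p)).

(* 4 (dx^2 + dy^2) / (1 - |z|^2)^2, of constant curvature -1 *)
Definition hyperbolic_metric (z : C) : 'M[R]_2 :=
  (4 / (1 - Cmod z ^+ 2) ^+ 2)%:M.

Definition product_metric (p : C * R) : 'M[R]_3 :=
  @block_mx R 2 1 2 1 (hyperbolic_metric p.1) 0 0 1%:M.

(* |G|^(-1/2) sum_i d_i (|G|^(1/2) sum_j G^(ij) d_j u) *)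
Definition laplace_beltrami (G : C * R -> 'M[R]_3) (u : C * R -> R)
    (p : C * R) : R :=
  (sqrt (\det (G p)))^-1 *
  \sum_(i < 3) partial i
    (fun q => sqrt (\det (G q)) * \sum_(j < 3) invmx (G q) i j * partial j u q)
    p.

Definition tau (F : C * R -> C) (p : C * R) : C :=
  (laplace_beltrami product_metric (fun q => Re (F q)) p,
   laplace_beltrami product_metric (fun q => Im (F q)) p).

Definition vanishes (F : C * R -> C) : Prop :=
  forall p : C * R, H2xR p -> F p = RtoC 0.

Definition r_harmonic (r : nat) (F : C * R -> C) : Prop :=
  smooth F /\ vanishes (iter r tau F).

Definition proper_r_harmonic (r : nat) (F : C * R -> C) : Prop :=
  r_harmonic r F /\ ~ vanishes (iter r.-1 tau F).

(* Main.v *)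
(* Re F and Im F are linear combinations of products of real parts of holomorphic
   and antiholomorphic functions of z with polynomials in t. On such functions the
   z-part of the Laplacian vanishes, since f_yy = i^2 f'' = - f_xx, so that tau acts
   as d^2/dt^2; hence tau^r F = (f + g) P^(2r) = 0, while P^(2r-2) is affine with
   coefficients proportional to b_(2r-2) and b_(2r-1).

   Smoothness requires that the derivative of a holomorphic function be holomorphic.
   Goursat's theorem on rectangles, applied to the difference quotient pulled back by
   zeta |-> z + exp zeta, gives 2 pi f'(z) = int (f(z + w) - f(z)) / w dtheta over the
   circles w = rho e^(i theta). This bounds f', then makes f' Lipschitz, and the
   formula can then be differentiated in z. *)
Require Import Defs.
From Stdlib Require Import Reals.
From mathcomp Require Import all_boot all_algebra.
From mathcomp Require Import Rstruct.
From Coquelicot Require Import Coquelicot.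
From Stdlib Require Import Lra Lia.

(* MathComp binds the key %R to ring_scope. *)
#[local] Delimit Scope R_scope with coqR.

(** * Goursat's theorem for closed forms on rectangles *)

Section Goursat.
Local Open Scope R_scope.

(** No continuity of f' is available at the start, so Green's formula is out of reach and closed
    forms are integrated by bisection. [has_partials] is total differentiability at one point, with
    gradient (a, b), in the sum norm. The exponential is chosen because rectangles then suffice:
    with zeta = s + it, the function q(zeta) = (f(z + e^zeta) - f(z)) e^(-zeta) is 2 pi-periodic in
    t, so that the horizontal sides of a rectangle of height 2 pi cancel and the integral over t
    does not depend on s = log(rho). Taking the difference quotient instead of f yields a formula
    for f' directly. Integrals and increments are estimated on real and imaginary parts separately,
    hence factors 2 and 4 pi where sharp bounds have 1 and 2 pi. Smoothness and the iteration of tau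
    both rest on one family of functions, Re ((f(z) + g(conj z)) (p(t) + i q(t))), stable under each
    coordinate derivative; the imaginary part of F belongs to it as well, through the pair (q,
    -p). *)

Definition has_partials (p : R -> R -> R) (x y a b : R) : Prop :=
  forall eps, 0 < eps -> exists d, 0 < d /\ forall u v,
    Rabs (u - x) < d -> Rabs (v - y) < d ->
    Rabs (p u v - p x y - a * (u - x) - b * (v - y))
      <= eps * (Rabs (u - x) + Rabs (v - y)).

Lemma has_partials_continuous_l p x y a b :
  has_partials p x y a b -> continuous (fun u => p u y) x.
Proof.
move=> H; apply continuity_pt_filterlim.
have [d [d0 Hd]] := H 1 Rlt_0_1.
move=> e e0.
have K0 : 0 < 1 + Rabs a by move: (Rabs_pos a); lra.
have K1 : 0 < e / (1 + Rabs a) by apply: Rdiv_lt_0_compat; lra.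
exists (Rmin d (e / (1 + Rabs a))); split; first by apply: Rmin_pos; lra.
move=> u [_ Hu]; rewrite /= /R_dist in Hu *.
have Hu1 : Rabs (u - x) < d by move: (Rmin_l d (e / (1 + Rabs a))); lra.
have Hu2 : Rabs (u - x) < e / (1 + Rabs a)
  by move: (Rmin_r d (e / (1 + Rabs a))); lra.
have := Hd u y Hu1; rewrite Rminus_diag Rabs_R0 => /(_ d0) H1.
have -> : p u y - p x y =
  (p u y - p x y - a * (u - x) - b * 0) + a * (u - x) by ring.
apply: Rle_lt_trans; first exact: Rabs_triang.
rewrite (Rabs_mult a).
apply: (Rle_lt_trans _ ((1 + Rabs a) * Rabs (u - x))); first lra.
have -> : e = (1 + Rabs a) * (e / (1 + Rabs a)) by field; lra.
exact: Rmult_lt_compat_l.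
Qed.

Lemma has_partials_sym p x y a b :
  has_partials p x y a b -> has_partials (fun u v => p v u) y x b a.
Proof.
move=> H eps e0; have [d [d0 Hd]] := H eps e0.
exists d; split=> // u v Hu Hv; have := Hd v u Hv Hu.
rewrite (Rplus_comm (Rabs (u - y))); congr (Rabs _ <= _); ring.
Qed.

Lemma has_partials_continuous_r p x y a b :
  has_partials p x y a b -> continuous (fun v => p x v) y.
Proof.
by move/has_partials_sym=> H; apply: (has_partials_continuous_l (fun u v => p v u)) H.
Qed.

(** Every left end lies below every right end, whatever their indices, so the supremum of the left
    ends is a common point. *)
Lemma nested_intervals (u w : nat -> R) :
  (forall n, 0 <= w n) -> (forall n, u n <= u (S n)) ->
  (forall n, u (S n) + w (S n) <= u n + w n) ->
  exists l, forall n, u n <= l <= u n + w n.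
Proof.
move=> w0 u1 u2.
have le_u n m : u n <= u (n + m)%coq_nat.
  elim: m => [|m IH]; first by rewrite Nat.add_0_r; lra.
  by rewrite Nat.add_succ_r; move: (u1 (n + m)%coq_nat); lra.
have le_w n m : u (n + m)%coq_nat + w (n + m)%coq_nat <= u n + w n.
  elim: m => [|m IH]; first by rewrite Nat.add_0_r; lra.
  by rewrite Nat.add_succ_r; move: (u2 (n + m)%coq_nat); lra.
have ub n m : u m <= u n + w n.
  have [h|h] := Nat.le_ge_cases m n.
    have := le_u m (Nat.sub n m).
    have -> : (m + Nat.sub n m)%coq_nat = n by lia.
    by move: (w0 n); lra.
  have := le_w n (Nat.sub m n).
  have -> : (n + Nat.sub m n)%coq_nat = m by lia.
  by move: (w0 m); lra.
have [||l [l1 l2]] := completeness (fun x => exists n, x = u n).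
- by exists (u 0%nat + w 0%nat) => _ [n ->].
- by exists (u 0%nat), 0%nat.
exists l => n; split; first by apply: l1; exists n.
by apply: l2 => _ [m ->].
Qed.

Variables p q : R -> R -> R.

(** The integral of the form p dx + q dy along the boundary of the rectangle, counterclockwise. *)
Definition circulation (x y w h : R) : R :=
  RInt (fun u => p u y) x (x + w) + RInt (q (x + w)) y (y + h)
  - RInt (fun u => p u (y + h)) x (x + w) - RInt (q x) y (y + h).

Variables x0 y0 w0 h0 : R.
Hypothesis w0_ge0 : 0 <= w0.
Hypothesis h0_ge0 : 0 <= h0.
(** The shared coefficient [b] is closedness, dp/dy = dq/dx, required pointwise and without
    continuity of the derivatives. *)
Hypothesis closed_form : forall x y, x0 <= x <= x0 + w0 -> y0 <= y <= y0 + h0 ->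
  exists a b c, has_partials p x y a b /\ has_partials q x y b c.

Lemma ex_RInt_horizontal y x x' : y0 <= y <= y0 + h0 ->
  x0 <= x -> x <= x' -> x' <= x0 + w0 -> ex_RInt (fun u => p u y) x x'.
Proof.
move=> Hy H1 H2 H3; apply: (ex_RInt_continuous (V := R_CompleteNormedModule)) => z.
rewrite Rmin_left // Rmax_right // => Hz.
have [||a [b [c [Hp _]]]] := closed_form z y; try lra.
exact: has_partials_continuous_l Hp.
Qed.

Lemma ex_RInt_vertical x y y' : x0 <= x <= x0 + w0 ->
  y0 <= y -> y <= y' -> y' <= y0 + h0 -> ex_RInt (q x) y y'.
Proof.
move=> Hx H1 H2 H3; apply: (ex_RInt_continuous (V := R_CompleteNormedModule)) => z.
rewrite Rmin_left // Rmax_right // => Hz.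
have [||a [b [c [_ Hq]]]] := closed_form x z; try lra.
exact: has_partials_continuous_r Hq.
Qed.

Lemma circulation_quarters x y w h : x0 <= x -> 0 <= w -> x + w <= x0 + w0 ->
  y0 <= y -> 0 <= h -> y + h <= y0 + h0 ->
  circulation x y w h =
  circulation x y (w / 2) (h / 2) + circulation (x + w / 2) y (w / 2) (h / 2)
  + circulation x (y + h / 2) (w / 2) (h / 2)
  + circulation (x + w / 2) (y + h / 2) (w / 2) (h / 2).
Proof.
move=> H1 H2 H3 H4 H5 H6; rewrite /circulation.
have -> : x + w / 2 + w / 2 = x + w by field.
have -> : y + h / 2 + h / 2 = y + h by field.
have Hp v : y0 <= v <= y0 + h0 -> RInt (fun u => p u v) x (x + w) =
   RInt (fun u => p u v) x (x + w / 2) + RInt (fun u => p u v) (x + w / 2) (x + w).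
  by move=> Hv; symmetry; apply: (RInt_Chasles (V := R_CompleteNormedModule));
    apply: ex_RInt_horizontal; lra.
have Hq u : x0 <= u <= x0 + w0 -> RInt (q u) y (y + h) =
   RInt (q u) y (y + h / 2) + RInt (q u) (y + h / 2) (y + h).
  by move=> Hv; symmetry; apply: (RInt_Chasles (V := R_CompleteNormedModule));
    apply: ex_RInt_vertical; lra.
rewrite !Hp; try lra; rewrite !Hq; try lra.
Qed.

(** The affine parts of p and q at (x, y) form a closed form with zero circulation, so only
    remainders count. On each pair of opposite sides two remainders of size eps (w + h) are
    integrated, over a length w or h. *)
Lemma circulation_local_bound x y a b c eps d x1 y1 w h :
  (forall u v, Rabs (u - x) < d -> Rabs (v - y) < d ->
    Rabs (p u v - p x y - a * (u - x) - b * (v - y))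
      <= eps * (Rabs (u - x) + Rabs (v - y))) ->
  (forall u v, Rabs (u - x) < d -> Rabs (v - y) < d ->
    Rabs (q u v - q x y - b * (u - x) - c * (v - y))
      <= eps * (Rabs (u - x) + Rabs (v - y))) ->
  0 <= eps -> 0 <= w -> 0 <= h -> w + h < d ->
  x1 <= x <= x1 + w -> y1 <= y <= y1 + h ->
  x0 <= x1 -> x1 + w <= x0 + w0 -> y0 <= y1 -> y1 + h <= y0 + h0 ->
  Rabs (circulation x1 y1 w h) <= 2 * eps * (w + h) * (w + h).
Proof.
move=> Hp Hq e0 w1 h1 wh Hx Hy X1 X2 Y1 Y2.
have near u v : x1 <= u <= x1 + w -> y1 <= v <= y1 + h ->
    [/\ Rabs (u - x) < d, Rabs (v - y) < d &
     eps * (Rabs (u - x) + Rabs (v - y)) <= eps * (w + h)].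
  move=> Hu Hv.
  have A : Rabs (u - x) <= w by apply: Rabs_le; lra.
  have B : Rabs (v - y) <= h by apply: Rabs_le; lra.
  by split; try lra; apply: Rmult_le_compat_l; lra.
(* The added constants remove the difference of the affine parts between opposite sides; they
   integrate to w (b h) and - h (b w), which cancel. *)
have -> : circulation x1 y1 w h =
   RInt (fun u => plus (minus (p u y1) (p u (y1 + h))) (b * h)) x1 (x1 + w)
   + RInt (fun v => plus (minus (q (x1 + w) v) (q x1 v)) (- (b * w))) y1 (y1 + h).
  have sub_const f g k s t : ex_RInt f s t -> ex_RInt g s t ->
      RInt (fun u => plus (minus (f u) (g u)) k) s t =
      RInt f s t - RInt g s t + (t - s) * k.
    move=> Hf Hg; apply: (is_RInt_unique (V := R_CompleteNormedModule)).
    apply: (is_RInt_plus (V := R_NormedModule)); last exact: is_RInt_const.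
    by apply: (is_RInt_minus (V := R_NormedModule));
      apply: (RInt_correct (V := R_CompleteNormedModule)).
  rewrite !sub_const;
    try (by apply: ex_RInt_horizontal; lra);
    try (by apply: ex_RInt_vertical; lra).
  rewrite /circulation; ring.
apply: Rle_trans; first exact: Rabs_triang.
have -> : 2 * eps * (w + h) * (w + h) =
   (x1 + w - x1) * (2 * (eps * (w + h))) + (y1 + h - y1) * (2 * (eps * (w + h)))
   by ring.
apply: Rplus_le_compat; apply: abs_RInt_le_const; try lra.
- apply: (ex_RInt_plus (V := R_NormedModule)); last exact: ex_RInt_const.
  by apply: (ex_RInt_minus (V := R_NormedModule)); apply: ex_RInt_horizontal; lra.
- move=> t Ht; rewrite /minus /plus /opp /=.
  have [|A1 A2 A3] := near t y1 Ht; first lra.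
  have [|B1 B2 B3] := near t (y1 + h) Ht; first lra.
  move: (Hp _ _ A1 A2) (Hp _ _ B1 B2) => {}A1 {}B1.
  have -> : p t y1 + - p t (y1 + h) + b * h =
     (p t y1 - p x y - a * (t - x) - b * (y1 - y)) -
     (p t (y1 + h) - p x y - a * (t - x) - b * (y1 + h - y)) by ring.
  by apply: Rle_trans; [exact: Rabs_triang | rewrite Rabs_Ropp; lra].
- apply: (ex_RInt_plus (V := R_NormedModule)); last exact: ex_RInt_const.
  by apply: (ex_RInt_minus (V := R_NormedModule)); apply: ex_RInt_vertical; lra.
- move=> t Ht; rewrite /minus /plus /opp /=.
  have [|A1 A2 A3] := near x1 t _ Ht; first lra.
  have [|B1 B2 B3] := near (x1 + w) t _ Ht; first lra.
  move: (Hq _ _ A1 A2) (Hq _ _ B1 B2) => {}A1 {}B1.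
  have -> : q (x1 + w) t + - q x1 t + - (b * w) =
     (q (x1 + w) t - q x y - b * (x1 + w - x) - c * (t - y)) -
     (q x1 t - q x y - b * (x1 - x) - c * (t - y)) by ring.
  by apply: Rle_trans; [exact: Rabs_triang | rewrite Rabs_Ropp; lra].
Qed.

(** Some quarter carries at least a fourth of the circulation in absolute value. Three quarters are
    tested and the last one is the default, which [bisection_step] justifies by the triangle
    inequality. *)
Fixpoint bisection (n : nat) : R * R :=
  match n with
  | O => (x0, y0)
  | S m =>
    let: (x, y) := bisection m in
    let w := w0 / 2 ^ m in let h := h0 / 2 ^ m in
    let large x1 y1 := Rle_dec (Rabs (circulation x y w h) / 4)
           (Rabs (circulation x1 y1 (w / 2) (h / 2))) in
    if large x y then (x, y) else
    if large (x + w / 2) y then (x + w / 2, y) else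
    if large x (y + h / 2) then (x, y + h / 2) else (x + w / 2, y + h / 2)
  end.

Lemma half_pow a n : a / 2 ^ (S n) = a / 2 ^ n / 2.
Proof. by rewrite /=; field; apply: pow_nonzero; lra. Qed.

Lemma bisection_bounds n :
  let: (x, y) := bisection n in
  [/\ x0 <= x, x + w0 / 2 ^ n <= x0 + w0, y0 <= y & y + h0 / 2 ^ n <= y0 + h0].
Proof.
elim: n => [|n]; first by rewrite /= !Rdiv_1_r; split; lra.
rewrite !half_pow /=; case: (bisection n) => x y [H1 H2 H3 H4].
have A : 0 <= w0 / 2 ^ n by apply: Rdiv_le_0_compat => //; apply: pow_lt; lra.
have B : 0 <= h0 / 2 ^ n by apply: Rdiv_le_0_compat => //; apply: pow_lt; lra.
by do 3!(case: Rle_dec => ? /=; first by split; lra); split; lra.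
Qed.

Lemma bisection_step n :
  let: (x, y) := bisection n in
  let: (x', y') := bisection (S n) in
  [/\ x <= x', x' + w0 / 2 ^ (S n) <= x + w0 / 2 ^ n,
   y <= y', y' + h0 / 2 ^ (S n) <= y + h0 / 2 ^ n &
   Rabs (circulation x y (w0 / 2 ^ n) (h0 / 2 ^ n)) / 4 <=
   Rabs (circulation x' y' (w0 / 2 ^ (S n)) (h0 / 2 ^ (S n)))].
Proof.
have := bisection_bounds n.
rewrite !half_pow /=; case: (bisection n) => x y [H1 H2 H3 H4].
have A : 0 <= w0 / 2 ^ n by apply: Rdiv_le_0_compat => //; apply: pow_lt; lra.
have B : 0 <= h0 / 2 ^ n by apply: Rdiv_le_0_compat => //; apply: pow_lt; lra.
case: Rle_dec => C1 /=; first by split; lra.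
case: Rle_dec => C2 /=; first by split; lra.
case: Rle_dec => C3 /=; first by split; lra.
split; try lra.
move: C1 C2 C3; rewrite /=.
rewrite (circulation_quarters x y (w0 / 2 ^ n) (h0 / 2 ^ n)); try lra.
set c1 := circulation x y _ _; set c2 := circulation _ y _ _.
set c3 := circulation x _ _ _; set c4 := circulation _ (y + _) _ _ => C1 C2 C3.
move: (Rabs_triang (c1 + c2 + c3) c4) (Rabs_triang (c1 + c2) c3) (Rabs_triang c1 c2).
lra.
Qed.

Lemma bisection_circulation n :
  let: (x, y) := bisection n in
  Rabs (circulation x0 y0 w0 h0) / 4 ^ n <=
  Rabs (circulation x y (w0 / 2 ^ n) (h0 / 2 ^ n)).
Proof.
elim: n => [|n IH]; first by rewrite /= !Rdiv_1_r; lra.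
move: (bisection_step n) IH.
case: (bisection n) => x y; case: (bisection (S n)) => x' y' [_ _ _ _ H] IH.
apply: Rle_trans H.
have -> : Rabs (circulation x0 y0 w0 h0) / 4 ^ S n =
  Rabs (circulation x0 y0 w0 h0) / 4 ^ n / 4 by rewrite /=; field; apply: pow_nonzero; lra.
lra.
Qed.

(** After N bisections the circulation is still at least K / 4^N, while differentiability at the
    common point bounds it by 2 eps (D / 2^N)^2. The powers of 4 cancel, and eps is arbitrary. *)
Theorem goursat : circulation x0 y0 w0 h0 = 0.
Proof.
have A n : 0 <= w0 / 2 ^ n by apply: Rdiv_le_0_compat => //; apply: pow_lt; lra.
have B n : 0 <= h0 / 2 ^ n by apply: Rdiv_le_0_compat => //; apply: pow_lt; lra.
have [||x Hx] := nested_intervals (fun n => fst (bisection n)) (fun n => w0 / 2 ^ n) A.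
- move=> n; move: (bisection_step n).
  by case: (bisection n) => ? ?; case: (bisection (S n)) => ? ? [].
- move=> n; move: (bisection_step n).
  by case: (bisection n) => ? ?; case: (bisection (S n)) => ? ? [].
have [||y Hy] := nested_intervals (fun n => snd (bisection n)) (fun n => h0 / 2 ^ n) B.
- move=> n; move: (bisection_step n).
  by case: (bisection n) => ? ?; case: (bisection (S n)) => ? ? [].
- move=> n; move: (bisection_step n).
  by case: (bisection n) => ? ?; case: (bisection (S n)) => ? ? [].
have [||a [b [c [Hp Hq]]]] := closed_form x y.
- by have := Hx 0%nat; rewrite /= Rdiv_1_r.
- by have := Hy 0%nat; rewrite /= Rdiv_1_r.
set K := Rabs (circulation x0 y0 w0 h0).
set D := w0 + h0.
have bound eps : 0 < eps -> K <= 2 * eps * D * D.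
  move=> e0; have [d1 [d10 H1]] := Hp _ e0; have [d2 [d20 H2]] := Hq _ e0.
  have d0 : 0 < Rmin d1 d2 by exact: Rmin_pos.
  (* Dividing by D + 1 instead of D admits the degenerate rectangle with D = 0. *)
  have [||N HN] := pow_lt_1_zero (/ 2) _ (Rmin d1 d2 / (D + 1)).
  - by rewrite Rabs_pos_eq; lra.
  - by apply: Rdiv_lt_0_compat => //; rewrite /D; lra.
  have {HN} := HN N (le_n N).
  have p2 : 0 < 2 ^ N by apply: pow_lt; lra.
  rewrite pow_inv Rabs_pos_eq; last by apply: Rlt_le; apply: Rinv_0_lt_compat.
  move=> HN.
  have small : w0 / 2 ^ N + h0 / 2 ^ N < Rmin d1 d2.
    have -> : w0 / 2 ^ N + h0 / 2 ^ N = D * / 2 ^ N by rewrite /D; field; lra.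
    apply: Rle_lt_trans (_ : (D + 1) * / 2 ^ N < _).
      by apply: Rmult_le_compat_r; [apply: Rlt_le; apply: Rinv_0_lt_compat | lra].
    have -> : Rmin d1 d2 = (D + 1) * (Rmin d1 d2 / (D + 1)) by field; rewrite /D; lra.
    by apply: Rmult_lt_compat_l => //; rewrite /D; lra.
  move: (Rmin_l d1 d2) (Rmin_r d1 d2) => m1 m2.
  move: (bisection_circulation N) (bisection_bounds N) (Hx N) (Hy N).
  case: (bisection N) => x1 y1 /= C1 [? ? ? ?] X Y.
  have C2 : Rabs (circulation x1 y1 (w0 / 2 ^ N) (h0 / 2 ^ N)) <=
     2 * eps * (w0 / 2 ^ N + h0 / 2 ^ N) * (w0 / 2 ^ N + h0 / 2 ^ N).
    apply: (@circulation_local_bound x y a b c eps (Rmin d1 d2)) => //; try lra.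
    - by move=> u v hu hv; apply: H1; lra.
    - by move=> u v hu hv; apply: H2; lra.
  have p4 : 4 ^ N = 2 ^ N * 2 ^ N by rewrite -Rpow_mult_distr; congr (_ ^ _); ring.
  have -> : K = 4 ^ N * (K / 4 ^ N) by rewrite p4; field; lra.
  have -> : 2 * eps * D * D =
     4 ^ N * (2 * eps * (w0 / 2 ^ N + h0 / 2 ^ N) * (w0 / 2 ^ N + h0 / 2 ^ N)).
    by rewrite p4 /D; field; lra.
  apply: Rmult_le_compat_l; first by apply: pow_le; lra.
  exact: Rle_trans C1 C2.
have K0 : K <= 0.
  apply: Rnot_lt_le => Kpos.
  have D0 : 0 <= D * D by apply: Rle_0_sqr.
  (* For this eps the bound 2 eps D^2 falls below K / 2, which contradicts 0 < K. *)
  have e0 : 0 < K / (4 * (D * D + 1)) by apply: Rdiv_lt_0_compat; lra.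
  have H := bound _ e0.
  have E : 2 * (K / (4 * (D * D + 1))) * D * D = K / 2 - K / (2 * (D * D + 1)) by field; lra.
  have : 0 < K / (2 * (D * D + 1)) by apply: Rdiv_lt_0_compat; lra.
  lra.
by apply: Rabs_eq_0; apply: Rle_antisym => //; apply: Rabs_pos.
Qed.

End Goursat.

(** * Complex differentiability and the Cauchy-Riemann equations *)

Section ComplexDerivative.
Local Set Implicit Arguments.
Local Unset Strict Implicit.
Local Open Scope R_scope.

(** Expressed through [Cmod] alone and without division, so that it does not depend on the uniform
    structure chosen on [C] and includes h = 0. *)
Definition cderiv (f : C -> C) (z l : C) : Prop :=
  forall eps, 0 < eps -> exists d, 0 < d /\ forall h, Cmod h < d ->
    Cmod (f (z + h) - f z - l * h)%C <= eps * Cmod h.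

Lemma Cmod_le_sum (z : C) : Cmod z <= Rabs (Re z) + Rabs (Im z).
Proof.
have -> : z = (RtoC (Re z) + (0%coqR, Im z))%C by rewrite /Cplus /= Rplus_0_l Rplus_0_r; case: (z).
apply: Rle_trans; first exact: Cmod_triangle.
rewrite Cmod_R /= Rplus_0_r Rplus_0_l; apply: Rplus_le_compat_l.
rewrite /Cmod /= Rmult_0_l Rplus_0_l Rmult_1_r -/(Rsqr (Im z)) sqrt_Rsqr_abs; exact: Rle_refl.
Qed.

Lemma im_le_Cmod (z : C) : Rabs (Im z) <= Cmod z.
Proof. by apply: Rle_trans (Rmax_Cmod z); exact: Rmax_r. Qed.

Lemma Re_lipschitz (w w' : C) : Rabs (Re w - Re w') <= Cmod (w - w')%C.
Proof. exact: (re_le_Cmod (w - w')%C). Qed.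

Lemma Im_lipschitz (w w' : C) : Rabs (Im w - Im w') <= Cmod (w - w')%C.
Proof. exact: (im_le_Cmod (w - w')%C). Qed.

Lemma is_derive_cderiv (f : C -> C) (z l : C) :
  @is_derive C_AbsRing C_NormedModule f z l <-> cderiv f z l.
Proof.
split.
- move=> [_ H] eps e0.
  have [d Hd] := H z (fun P HP => HP) (mkposreal _ e0).
  exists d; split; first exact: cond_pos.
  move=> h hd.
  have E : (z + h - z = h)%C by ring.
  have := Hd (z + h)%C; rewrite /ball /= /AbsRing_ball /= /minus /plus /opp /=.
  rewrite -/(Cminus (z + h)%C z) E => /(_ hd).
  by rewrite /norm /= /scal /= /mult /= (Cmult_comm h l).
- move=> H; split; first by apply (is_linear_scal_l (V := C_NormedModule) l).
  move=> w Hw; have <- : z = w by apply (is_filter_lim_locally_unique (K := C_AbsRing) (V := AbsRing_NormedModule C_AbsRing)).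
  move=> eps; have [d [d0 Hd]] := H eps (cond_pos eps).
  exists (mkposreal _ d0) => y; rewrite /ball /= /AbsRing_ball /= => Hy.
  have := Hd _ Hy; rewrite /minus /plus /opp /=.
  have -> : (z + (y + - z) = y)%C by ring.
  by rewrite /norm /= /scal /= /mult /= (Cmult_comm l).
Qed.

(* Coquelicot's product and composition rules see C as a module over itself, with
   a uniform structure that differs from that of C_NormedModule. *)
Lemma is_derive_cderiv_abs (f : C -> C) (z l : C) :
  @is_derive C_AbsRing (AbsRing_NormedModule C_AbsRing) f z l <-> cderiv f z l.
Proof.
by split=> [[_ H]|/is_derive_cderiv [_ H]]; [apply/is_derive_cderiv|];
  split=> //; exact: is_linear_scal_l.
Qed.

Lemma cderiv_comp f g z lf lg :
  cderiv f (g z) lf -> cderiv g z lg -> cderiv (fun w => f (g w)) z (lf * lg)%C.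
Proof.
move=> /is_derive_cderiv Hf /is_derive_cderiv_abs Hg.
apply/is_derive_cderiv; rewrite Cmult_comm.
exact: (is_derive_comp f g z lf lg Hf Hg).
Qed.

Lemma cderiv_mult f g z lf lg : cderiv f z lf -> cderiv g z lg ->
  cderiv (fun w => f w * g w)%C z (lf * g z + f z * lg)%C.
Proof.
move=> /is_derive_cderiv_abs Hf /is_derive_cderiv_abs Hg.
apply/is_derive_cderiv_abs.
exact: (is_derive_mult (K := C_AbsRing) f g z lf lg Hf Hg Cmult_comm).
Qed.

Lemma cderiv_plus f g z lf lg : cderiv f z lf -> cderiv g z lg ->
  cderiv (fun w => f w + g w)%C z (lf + lg)%C.
Proof.
move=> /is_derive_cderiv Hf /is_derive_cderiv Hg.
by apply/is_derive_cderiv; exact: (is_derive_plus f g).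
Qed.

Lemma cderiv_const c z : cderiv (fun _ => c) z 0%C.
Proof. apply/is_derive_cderiv; exact: (@is_derive_const C_AbsRing C_NormedModule c z). Qed.

Lemma cderiv_id z : cderiv (fun w => w) z 1%C.
Proof. apply/is_derive_cderiv_abs; exact: (@is_derive_id C_AbsRing z). Qed.

Lemma cderiv_linear a z : cderiv (fun w => a * w)%C z a.
Proof.
have := cderiv_mult (cderiv_const a z) (cderiv_id z).
by have -> : (0 * z + a * 1 = a)%C by ring.
Qed.

Lemma cderiv_ext f g z l d : 0 < d ->
  (forall w, Cmod (w - z)%C < d -> f w = g w) -> cderiv f z l -> cderiv g z l.
Proof.
move=> d0 H Hf eps e0; have [d' [d'0 Hd]] := Hf eps e0.
exists (Rmin d d'); split; first exact: Rmin_pos.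
move=> h hh; rewrite -!H.
- by apply: Hd; move: (Rmin_r d d'); lra.
- have -> : (z - z = 0)%C by ring.
  by rewrite Cmod_0.
- have -> : (z + h - z = h)%C by ring.
  by move: (Rmin_l d d'); lra.
Qed.

Lemma cderiv_continuous f z l : cderiv f z l ->
  forall eps, 0 < eps -> exists d, 0 < d /\
    forall w, Cmod (w - z)%C < d -> Cmod (f w - f z)%C < eps.
Proof.
move=> H eps e0; have [d [d0 Hd]] := H 1 Rlt_0_1.
have l0 := Cmod_ge_0 l.
exists (Rmin d (eps / (2 + Cmod l))); split.
  by apply: Rmin_pos => //; apply: Rdiv_lt_0_compat; lra.
move=> w Hw.
move: (Rmin_l d (eps / (2 + Cmod l))) (Rmin_r d (eps / (2 + Cmod l))) => m1 m2.
have := Hd (w - z)%C; have -> : (z + (w - z) = w)%C by ring.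
move=> /(_ ltac:(lra)) H1.
have -> : (f w - f z = (f w - f z - l * (w - z)) + l * (w - z))%C by ring.
apply: Rle_lt_trans; first exact: Cmod_triangle.
rewrite (Cmod_mult l).
have : (1 + Cmod l) * Cmod (w - z)%C <= (1 + Cmod l) * (eps / (2 + Cmod l)).
  by apply: Rmult_le_compat_l; lra.
have -> : (1 + Cmod l) * (eps / (2 + Cmod l)) = eps - eps / (2 + Cmod l) by field; lra.
have : 0 < eps / (2 + Cmod l) by apply: Rdiv_lt_0_compat; lra.
lra.
Qed.

(** Multiplication by l acts on the plane with real part Re l du - Im l dv. Together with the lemma
    on [Im] this is Cauchy-Riemann: Im f dx + Re f dy is closed, with Re l as shared coefficient. *)
Lemma cderiv_has_partials_Re f x y l : cderiv f (x, y) l ->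
  has_partials (fun u v => Re (f (u, v))) x y (Re l) (- Im l).
Proof.
move=> H eps e0; have [d [d0 Hd]] := H eps e0.
exists (d / 2); split; first lra.
move=> u v Hu Hv.
have A := Cmod_le_sum (u - x, v - y); rewrite /= in A.
have := Hd (u - x, v - y); rewrite /Cplus /= !Rplus_minus => /(_ ltac:(lra)) => B.
apply: Rle_trans (_ : eps * Cmod (u - x, v - y) <= _); last by apply: Rmult_le_compat_l; lra.
apply: Rle_trans B; apply: Rle_trans (re_le_Cmod _) => /=; right; congr Rabs; rewrite /Re /Im /=; ring.
Qed.

Lemma cderiv_has_partials_Im f x y l : cderiv f (x, y) l ->
  has_partials (fun u v => Im (f (u, v))) x y (Im l) (Re l).
Proof.
move=> H eps e0; have [d [d0 Hd]] := H eps e0.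
exists (d / 2); split; first lra.
move=> u v Hu Hv.
have A := Cmod_le_sum (u - x, v - y); rewrite /= in A.
have := Hd (u - x, v - y); rewrite /Cplus /= !Rplus_minus => /(_ ltac:(lra)) => B.
apply: Rle_trans (_ : eps * Cmod (u - x, v - y) <= _); last by apply: Rmult_le_compat_l; lra.
apply: Rle_trans B; apply: Rle_trans (im_le_Cmod _) => /=; right; congr Rabs; rewrite /Re /Im /=; ring.
Qed.

End ComplexDerivative.

(** * The complex exponential and the integral formula for the derivative *)

Section CircleFormula.
Local Set Implicit Arguments.
Local Unset Strict Implicit.
Local Open Scope R_scope.

Definition cexp (z : C) : C := (exp (Re z) * cos (Im z), exp (Re z) * sin (Im z)).

Lemma exp_le_mono x y : x <= y -> exp x <= exp y.
Proof. by case=> [/exp_increasing|->]; lra. Qed.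

Lemma cexp_plus z w : cexp (z + w)%C = (cexp z * cexp w)%C.
Proof.
rewrite /cexp /Cplus /Cmult /Re /Im /= exp_plus cos_plus sin_plus.
by congr pair; ring.
Qed.

Lemma cexp_0 : cexp 0%C = 1%C.
Proof. by rewrite /cexp /= exp_0 cos_0 sin_0 Rmult_1_l Rmult_0_r. Qed.

Lemma cexp_mul_opp z : (cexp z * cexp (- z))%C = 1%C.
Proof. by rewrite -cexp_plus Cplus_opp_r cexp_0. Qed.

Lemma Cmod_cexp z : Cmod (cexp z) = exp (Re z).
Proof.
rewrite /Cmod /cexp /=.
have -> : exp (Re z) * cos (Im z) * (exp (Re z) * cos (Im z) * 1) +
  exp (Re z) * sin (Im z) * (exp (Re z) * sin (Im z) * 1) =
  Rsqr (exp (Re z)) * (Rsqr (sin (Im z)) + Rsqr (cos (Im z))) by rewrite /Rsqr; ring.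
rewrite sin2_cos2 Rmult_1_r sqrt_Rsqr //; apply: Rlt_le; exact: exp_pos.
Qed.

Lemma cexp_2PI s : cexp (s, (2 * PI)%coqR) = cexp (s, 0%coqR).
Proof. by rewrite /cexp /= cos_2PI sin_2PI cos_0 sin_0. Qed.

Lemma cexp_opp_2PI s : cexp (- (s, 2 * PI)%coqR)%C = cexp (- (s, 0)%coqR)%C.
Proof. by rewrite /cexp /= cos_neg sin_neg Ropp_0 cos_2PI sin_2PI cos_0 sin_0 Ropp_0. Qed.

Lemma cderiv_cexp_0 : cderiv cexp 0%C 1%C.
Proof.
move=> eps e0.
(* Six terms of size at most e |h| arise below, three in each of [re] and [im], so eps / 8 suffices.
   The bound e <= 1 gives |1 + x| <= 2 and, with d <= e / 2, |sin y| <= 2 |y| <= e. *)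
set e := Rmin 1 (eps / 8).
have e1 : 0 < e by apply: Rmin_pos; lra.
have e2 : e <= 1 by exact: Rmin_l.
have e3 : e <= eps / 8 by exact: Rmin_r.
have near f l : derivable_pt_lim f 0 l -> exists d, 0 < d /\
    forall x, Rabs x < d -> Rabs (f x - f 0 - l * x) <= e * Rabs x.
  move=> /(_ _ e1) [d Hd]; exists d; split; first exact: cond_pos.
  move=> x Hx; have [->|x0] := Req_dec x 0.
    rewrite Rminus_diag Rmult_0_r Rminus_0_r Rabs_R0; lra.
  have := Hd x x0 Hx; rewrite Rplus_0_l => H.
  have -> : f x - f 0 - l * x = ((f x - f 0) / x - l) * x by field.
  by rewrite Rabs_mult; apply: Rmult_le_compat_r; [exact: Rabs_pos | lra].
have [d1 [d10 H1]] := near exp 1 derivable_pt_lim_exp_0.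
have [d2 [d20 H2]] := near sin _ (derivable_pt_lim_sin 0).
have [d3 [d30 H3]] := near cos _ (derivable_pt_lim_cos 0).
set d := Rmin (Rmin d1 d2) (Rmin d3 (e / 2)).
have D1 : d <= d1 by apply: Rle_trans (Rmin_l _ _) (Rmin_l _ _).
have D2 : d <= d2 by apply: Rle_trans (Rmin_l _ _) (Rmin_r _ _).
have D3 : d <= d3 by apply: Rle_trans (Rmin_r _ _) (Rmin_l _ _).
have D4 : d <= e / 2 by apply: Rle_trans (Rmin_r _ _) (Rmin_r _ _).
exists d; split; first by do ![apply: Rmin_pos => //]; lra.
move=> [x y] h; rewrite cexp_0 Cplus_0_l Cmult_1_l.
have hx : Rabs x < d by apply: Rle_lt_trans h; exact: (re_le_Cmod (x, y)).
have hy : Rabs y < d by apply: Rle_lt_trans h; exact: (im_le_Cmod (x, y)).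
have {}H1 := H1 x ltac:(lra); rewrite exp_0 Rmult_1_l in H1.
have {}H2 := H2 y ltac:(lra); rewrite sin_0 cos_0 Rmult_1_l Rminus_0_r in H2.
have {}H3 := H3 y ltac:(lra); rewrite cos_0 sin_0 Ropp_0 Rmult_0_l Rminus_0_r in H3.
apply: Rle_trans; first exact: Cmod_le_sum.
have mx : Rabs x <= Cmod (x, y) by exact: (re_le_Cmod (x, y)).
have my : Rabs y <= Cmod (x, y) by exact: (im_le_Cmod (x, y)).
have c1 : Rabs (cos y) <= 1 by apply: Rabs_le; exact: COS_bound.
have s1 : Rabs (sin y) <= 1 by apply: Rabs_le; exact: SIN_bound.
have px := Rabs_pos x; have py := Rabs_pos y.
have s2 : Rabs (sin y) <= e.
  have -> : sin y = (sin y - y) + y by ring.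
  apply: Rle_trans; first exact: Rabs_triang.
  have : e * Rabs y <= 1 * Rabs y by apply: Rmult_le_compat_r.
  lra.
have re : Rabs (Re (cexp (x, y) - 1 - (x, y))%C) <= e * Rabs x + 2 * (e * Rabs y).
  have -> : Re (cexp (x, y) - 1 - (x, y))%C = (exp x - 1 - x) * cos y + (1 + x) * (cos y - 1).
    by rewrite /Re /cexp /=; ring.
  apply: Rle_trans; first exact: Rabs_triang.
  rewrite !Rabs_mult; apply: Rplus_le_compat.
    rewrite -(Rmult_1_r (e * _)); apply: Rmult_le_compat => //; exact: Rabs_pos.
  apply: Rmult_le_compat => //; try exact: Rabs_pos.
  by apply: Rle_trans; [exact: Rabs_triang | rewrite Rabs_R1; lra].
have im : Rabs (Im (cexp (x, y) - 1 - (x, y))%C) <= e * Rabs x + Rabs x * e + e * Rabs y.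
  have -> : Im (cexp (x, y) - 1 - (x, y))%C = (exp x - 1 - x) * sin y + x * sin y + (sin y - y).
    by rewrite /Im /cexp /=; ring.
  apply: Rle_trans; first exact: Rabs_triang.
  apply: Rplus_le_compat => //.
  apply: Rle_trans; first exact: Rabs_triang.
  rewrite !Rabs_mult; apply: Rplus_le_compat.
    rewrite -(Rmult_1_r (e * _)); apply: Rmult_le_compat => //; exact: Rabs_pos.
  exact: Rmult_le_compat_l.
apply: Rle_trans (Rplus_le_compat _ _ _ _ re im) _.
have a1 : e * Rabs x <= e * Cmod (x, y) by apply: Rmult_le_compat_l; lra.
have a2 : e * Rabs y <= e * Cmod (x, y) by apply: Rmult_le_compat_l; lra.
have a3 : e * Cmod (x, y) <= eps / 8 * Cmod (x, y) by apply: Rmult_le_compat_r => //; exact: Cmod_ge_0.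
have a4 : 0 <= eps * Cmod (x, y) by apply: Rmult_le_pos; [lra | exact: Cmod_ge_0].
lra.
Qed.

Lemma cderiv_cexp z : cderiv cexp z (cexp z).
Proof.
have H : cderiv (fun w => cexp (- z + w))%C z 1%C.
  have := cderiv_comp (f := cexp) (g := fun w => (- z + w)%C) (z := z) (lf := 1%C) (lg := 1%C).
  have -> : (1 * 1 = 1)%C by ring.
  apply; first by have -> : (- z + z = 0)%C by [ring]; exact: cderiv_cexp_0.
  have := cderiv_plus (cderiv_const (- z)%C z) (cderiv_id z).
  by rewrite Cplus_0_l.
have := cderiv_mult (cderiv_const (cexp z) z) H.
have -> : (0 * cexp (- z + z) + cexp z * 1 = cexp z)%C by ring.
apply: (cderiv_ext (d := 1)); first exact: Rlt_0_1.
by move=> w _; rewrite -cexp_plus; congr cexp; ring.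
Qed.

Lemma cderiv_continuous_vertical f s t l : cderiv f (s, t) l ->
  continuous (fun u => Re (f (s, u))) t /\ continuous (fun u => Im (f (s, u))) t.
Proof.
move=> H; split.
- exact: has_partials_continuous_r (cderiv_has_partials_Re H).
- exact: has_partials_continuous_r (cderiv_has_partials_Im H).
Qed.

(** Goursat's theorem applied to Im (f dzeta) = Im f ds + Re f dt; the period 2 pi in t makes the
    two horizontal sides cancel. *)
Lemma RInt_vertical_eq f s0 s1 :
  s0 <= s1 ->
  (forall s t, s0 <= s <= s1 -> exists l, cderiv f (s, t) l) ->
  (forall s, f (s, (2 * PI)%coqR) = f (s, 0%coqR)) ->
  RInt (fun t => Re (f (s0, t))) 0 (2 * PI) = RInt (fun t => Re (f (s1, t))) 0 (2 * PI).
Proof.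
move=> le_s Hf per.
have pi0 := PI_RGT_0.
have H : circulation (fun s t => Im (f (s, t))) (fun s t => Re (f (s, t)))
    s0 0 (s1 - s0) (2 * PI) = 0.
  apply: goursat; try lra.
  move=> x y Hx _; have [|l Hl] := Hf x y; first lra.
  exists (Im l), (Re l), (- Im l); split.
  - exact: cderiv_has_partials_Im.
  - exact: cderiv_has_partials_Re.
move: H; rewrite /circulation Rplus_minus Rplus_0_l.
rewrite (RInt_ext (fun u => Im (f (u, (2 * PI)%coqR))) (fun u => Im (f (u, 0%coqR)))); last first.
  by move=> x _; rewrite per.
by move=> H; apply: Rminus_diag_uniq; lra.
Qed.

(** The quotient (f(z + w) - f(z)) / w at w = e^zeta, with division written as the factor e^(-zeta),
    which the product rule handles with no side condition. *)
Definition difference_quotient (f : C -> C) (z zeta : C) : C :=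
  ((f (z + cexp zeta) - f z) * cexp (- zeta))%C.

Lemma cderiv_difference_quotient f z zeta l : cderiv f (z + cexp zeta)%C l ->
  exists m, cderiv (difference_quotient f z) zeta m.
Proof.
move=> H; eexists; apply: cderiv_mult.
- apply: cderiv_plus; last exact: cderiv_const.
  apply: (cderiv_comp (g := fun w => (z + cexp w)%C)); first exact: H.
  by apply: cderiv_plus; [exact: cderiv_const | exact: cderiv_cexp].
- apply: (cderiv_comp (g := fun w => (- w)%C)); first exact: cderiv_cexp.
  apply: (cderiv_ext (d := 1) (f := fun w => (- (1) * w)%C)); first exact: Rlt_0_1.
    by move=> w _; ring.
  exact: cderiv_linear.
Qed.

Lemma difference_quotient_sub f z zeta l :
  (difference_quotient f z zeta - l =
   (f (z + cexp zeta) - f z - l * cexp zeta) * cexp (- zeta))%C.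
Proof.
rewrite /difference_quotient.
have E := cexp_mul_opp zeta.
have -> : ((f (z + cexp zeta) - f z - l * cexp zeta) * cexp (- zeta) =
  (f (z + cexp zeta) - f z) * cexp (- zeta) - l * (cexp zeta * cexp (- zeta)))%C by ring.
by rewrite E; ring.
Qed.

Lemma Cmod_cexp_opp z : Cmod (cexp (- z)) = / Cmod (cexp z).
Proof. by rewrite !Cmod_cexp /= exp_Ropp. Qed.

Definition angular_integral (k : R -> C) : C :=
  (RInt (fun t => Re (k t)) 0 (2 * PI), RInt (fun t => Im (k t)) 0 (2 * PI)).

Definition angular_integrable (k : R -> C) : Prop :=
  ex_RInt (fun t => Re (k t)) 0 (2 * PI) /\ ex_RInt (fun t => Im (k t)) 0 (2 * PI).

Lemma angular_integrable_difference_quotient f z s :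
  (forall w, Cmod (w - z)%C = exp s -> exists l, cderiv f w l) ->
  angular_integrable (fun t => difference_quotient f z (s, t)).
Proof.
move=> H.
have D t : exists m, cderiv (difference_quotient f z) (s, t) m.
  have [|l Hl] := H (z + cexp (s, t))%C; last exact: cderiv_difference_quotient Hl.
  have -> : (z + cexp (s, t) - z = cexp (s, t))%C by ring.
  by rewrite Cmod_cexp.
by split; apply: (ex_RInt_continuous (V := R_CompleteNormedModule)) => t _;
  have [m /cderiv_continuous_vertical []] := D t.
Qed.

(* Pulling back by the exponential turns circles into vertical segments, so that
   Goursat's theorem on rectangles makes the mean of the difference quotient
   independent of the radius; letting the radius tend to 0 gives f'(z). *)
Lemma circle_formula f z s l :
  (forall w, Cmod (w - z)%C <= exp s -> exists l, cderiv f w l) ->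
  cderiv f z l ->
  angular_integral (fun t => difference_quotient f z (s, t)) = (2 * PI * l)%C.
Proof.
move=> Hf Hl.
have pi0 := PI_RGT_0.
set q := difference_quotient f z.
have Dq s' t : s' <= s -> exists m, cderiv q (s', t) m.
  move=> le_s; have [|m Hm] := Hf (z + cexp (s', t))%C; last exact: cderiv_difference_quotient Hm.
  have -> : (z + cexp (s', t) - z = cexp (s', t))%C by ring.
  by rewrite Cmod_cexp /=; apply: exp_le_mono.
have per s' : q (s', (2 * PI)%coqR) = q (s', 0%coqR).
  by rewrite /q /difference_quotient cexp_2PI cexp_opp_2PI.
have small eps : 0 < eps -> exists s', s' <= s /\ forall t, Cmod (q (s', t) - l)%C <= eps.
  move=> e0; have [d [d0 Hd]] := Hl eps e0.
  (* The radius exp s' is then at most d / 2, inside the disc where the derivative at z controls the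
     quotient. *)
  exists (Rmin s (ln (d / 2))); split; first exact: Rmin_l.
  move=> t; rewrite /q difference_quotient_sub Cmod_mult Cmod_cexp_opp.
  set zeta := (_, t).
  have m0 : 0 < Cmod (cexp zeta) by rewrite Cmod_cexp; exact: exp_pos.
  have m1 : Cmod (cexp zeta) < d.
    rewrite Cmod_cexp /=; apply: Rle_lt_trans (_ : exp (ln (d / 2)) < _).
      by apply: exp_le_mono; exact: Rmin_r.
    by rewrite exp_ln; lra.
  apply: Rle_trans (_ : eps * Cmod (cexp zeta) * / Cmod (cexp zeta) <= _).
    by apply: Rmult_le_compat_r; [apply: Rlt_le; exact: Rinv_0_lt_compat | exact: Hd].
  by right; field; lra.
(* [F] stands for [Re] or [Im]. The integral at s equals the one at a small radius, where the
   integrand is uniformly within eps / (4 pi) of its limit, so the total error is at most eps /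
   2. *)
have close (F : C -> R) : (forall s', s' <= s ->
       RInt (fun t => F (q (s', t))) 0 (2 * PI) = RInt (fun t => F (q (s, t))) 0 (2 * PI)) ->
    (forall s', s' <= s -> ex_RInt (fun t => F (q (s', t))) 0 (2 * PI)) ->
    (forall w w', Rabs (F w - F w') <= Cmod (w - w')%C) ->
    RInt (fun t => F (q (s, t))) 0 (2 * PI) = 2 * PI * F l.
  move=> inv_s exq lip; apply: Rminus_diag_uniq; apply: cond_eq => eps e0.
  have [|s' [le_s Hs]] := small (eps / (4 * PI)); first by apply: Rdiv_lt_0_compat; lra.
  rewrite Rminus_0_r -(inv_s s') //.
  have -> : RInt (fun t => F (q (s', t))) 0 (2 * PI) - 2 * PI * F l =
      RInt (fun t => minus (F (q (s', t))) (F l)) 0 (2 * PI).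
    rewrite RInt_minus; [|exact: exq|exact: ex_RInt_const].
    by rewrite RInt_const /minus /plus /opp /scal /= /mult /=; ring.
  apply: Rle_lt_trans (_ : (2 * PI - 0) * (eps / (4 * PI)) < _).
    apply: abs_RInt_le_const; first lra.
      by apply: (ex_RInt_minus (V := R_NormedModule)); [exact: exq | exact: ex_RInt_const].
    by move=> t _; apply: Rle_trans (lip _ _) (Hs t).
  have -> : (2 * PI - 0) * (eps / (4 * PI)) = eps / 2 by field; lra.
  lra.
have inv_q (g : C -> C) : (forall s' t, s' <= s -> exists m, cderiv g (s', t) m) ->
    (forall s', g (s', (2 * PI)%coqR) = g (s', 0%coqR)) -> forall s', s' <= s ->
    RInt (fun t => Re (g (s', t))) 0 (2 * PI) = RInt (fun t => Re (g (s, t))) 0 (2 * PI).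
  by move=> Dg pg s' le_s; apply: RInt_vertical_eq => // a t Ha; apply: Dg; lra.
rewrite /angular_integral; apply: injective_projections => /=.
- rewrite (close Re); last exact: Re_lipschitz.
  + by rewrite /Re; ring.
  + exact: inv_q.
  + move=> s' le_s; apply: (ex_RInt_continuous (V := R_CompleteNormedModule)) => t _.
    by have [m /cderiv_continuous_vertical []] := Dq s' t le_s.
- rewrite (close Im); last exact: Im_lipschitz.
  + by rewrite /Im; ring.
  + move=> s' le_s.
    (* Invariance in s is known for real parts only; it is applied to -i q to reach the imaginary
       part of q. *)
    have E x : Im x = Re (- Ci * x)%C by rewrite /Im /Re /=; ring.
    rewrite !(RInt_ext (fun t => Im _) _ _ _ (fun t _ => E _)).
    apply: (inv_q (fun w => - Ci * q w)%C) => //; last by move=> a; rewrite per.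
    move=> a t Ha; have [m Hm] := Dq a t Ha.
    by eexists; apply: cderiv_mult; [exact: cderiv_const | exact: Hm].
  + move=> s' le_s; apply: (ex_RInt_continuous (V := R_CompleteNormedModule)) => t _.
    by have [m /cderiv_continuous_vertical []] := Dq s' t le_s.
Qed.

(** The two components are bounded by 2 pi M each and added, hence 4 pi. *)
Lemma angular_integral_bound k M : angular_integrable k ->
  (forall t, Cmod (k t) <= M) -> Cmod (angular_integral k) <= 4 * PI * M.
Proof.
move=> [H1 H2] HM; have pi0 := PI_RGT_0.
apply: Rle_trans (Cmod_le_sum _) _.
have -> : 4 * PI * M = (2 * PI - 0) * M + (2 * PI - 0) * M by ring.
apply: Rplus_le_compat; apply: abs_RInt_le_const => //; try lra; move=> t _.
- exact: Rle_trans (re_le_Cmod _) (HM t).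
- exact: Rle_trans (im_le_Cmod _) (HM t).
Qed.

Lemma angular_integral_sub k1 k2 a : angular_integrable k1 -> angular_integrable k2 ->
  angular_integrable (fun t => k1 t - a * k2 t)%C /\
  angular_integral (fun t => k1 t - a * k2 t)%C =
    (angular_integral k1 - a * angular_integral k2)%C.
Proof.
move=> [A1 B1] [A2 B2].
have I1 := RInt_correct (V := R_CompleteNormedModule) _ _ _ A1.
have I2 := RInt_correct (V := R_CompleteNormedModule) _ _ _ B1.
have I3 := RInt_correct (V := R_CompleteNormedModule) _ _ _ A2.
have I4 := RInt_correct (V := R_CompleteNormedModule) _ _ _ B2.
have X := is_RInt_minus (V := R_NormedModule) _ _ _ _ _ _ I1
  (is_RInt_minus (V := R_NormedModule) _ _ _ _ _ _
    (is_RInt_scal (V := R_NormedModule) _ _ _ (Re a) _ I3)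
    (is_RInt_scal (V := R_NormedModule) _ _ _ (Im a) _ I4)).
have Y := is_RInt_minus (V := R_NormedModule) _ _ _ _ _ _ I2
  (is_RInt_plus (V := R_NormedModule) _ _ _ _ _ _
    (is_RInt_scal (V := R_NormedModule) _ _ _ (Re a) _ I4)
    (is_RInt_scal (V := R_NormedModule) _ _ _ (Im a) _ I3)).
by split; [split; eexists; [exact: X | exact: Y] |
  congr pair; apply: (is_RInt_unique (V := R_CompleteNormedModule)); [exact: X | exact: Y]].
Qed.

End CircleFormula.

(** * The derivative of a holomorphic function is holomorphic *)

Section DerivativeHolomorphic.
Local Set Implicit Arguments.
Local Unset Strict Implicit.
Local Open Scope R_scope.

Lemma angular_integral_bound_difference_quotient f z s K :
  angular_integrable (fun t => difference_quotient f z (s, t)) ->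
  (forall w, Cmod (w - z)%C = exp s -> Cmod (f w - f z)%C <= K) ->
  Cmod (angular_integral (fun t => difference_quotient f z (s, t))) <= 4 * PI * (K * exp (- s)).
Proof.
move=> Hi HK; apply: angular_integral_bound => // t.
rewrite /difference_quotient Cmod_mult Cmod_cexp /=.
apply: Rmult_le_compat_r; first by apply: Rlt_le; exact: exp_pos.
apply: HK; have -> : (z + cexp (s, t) - z = cexp (s, t))%C by ring.
by rewrite Cmod_cexp.
Qed.

Lemma Cmod_2PI l : Cmod (2 * PI * l)%C = 2 * PI * Cmod l.
Proof.
have pi0 := PI_RGT_0.
by rewrite !Cmod_mult !Cmod_R !Rabs_pos_eq; lra.
Qed.

(** [K] measures the oscillation f - f(z) on the circle rather than the size of f, which suits
    increments of f. The factor 2 is 4 pi / (2 pi). *)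
Lemma cauchy_estimate f z s l K :
  (forall w, Cmod (w - z)%C <= exp s -> exists m, cderiv f w m) ->
  cderiv f z l ->
  (forall w, Cmod (w - z)%C = exp s -> Cmod (f w - f z)%C <= K) ->
  Cmod l <= 2 * K * exp (- s).
Proof.
move=> Hf Hl HK; have pi0 := PI_RGT_0.
have Hi : angular_integrable (fun t => difference_quotient f z (s, t)).
  by apply: angular_integrable_difference_quotient => w Hw; apply: Hf; lra.
have := angular_integral_bound_difference_quotient Hi HK.
rewrite (circle_formula Hf Hl) Cmod_2PI => H.
apply: (Rmult_le_reg_l (2 * PI)); first lra.
by apply: Rle_trans H _; right; ring.
Qed.

Lemma cderiv_line f z h t l : cderiv f (z + RtoC t * h)%C l ->
  is_derive (fun u => Re (f (z + RtoC u * h)%C)) t (Re (l * h)%C) /\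
  is_derive (fun u => Im (f (z + RtoC u * h)%C)) t (Im (l * h)%C).
Proof.
move=> H.
have key eps : 0 < eps -> exists d : posreal, forall k, k <> 0 -> Rabs k < d ->
    Cmod (f (z + RtoC (t + k) * h) - f (z + RtoC t * h) - RtoC k * (l * h))%C / Rabs k < eps.
  move=> e0; have h0 := Cmod_ge_0 h.
  (* The complex increment is k h; dividing by 1 + |h| allows h = 0 and makes the final inequality
     strict. *)
  have [|d [d0 Hd]] := H (eps / (1 + Cmod h)); first by apply: Rdiv_lt_0_compat; lra.
  have dd : 0 < d / (1 + Cmod h) by apply: Rdiv_lt_0_compat; lra.
  exists (mkposreal _ dd) => k k0 /= Hk.
  have kp : 0 < Rabs k by exact: Rabs_pos_lt.
  have := Hd (RtoC k * h)%C; rewrite Cmod_mult Cmod_R.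
  have -> : (z + RtoC t * h + RtoC k * h = z + RtoC (t + k) * h)%C.
    by rewrite RtoC_plus; ring.
  have -> : (l * (RtoC k * h) = RtoC k * (l * h))%C by ring.
  move=> X; have {}X := X _.
  have lt : Rabs k * Cmod h < d.
    apply: Rle_lt_trans (_ : Rabs k * (1 + Cmod h) < _); first by apply: Rmult_le_compat_l; lra.
    have -> : d = d / (1 + Cmod h) * (1 + Cmod h) by field; lra.
    by apply: Rmult_lt_compat_r; lra.
  move: (X lt) => {}X.
  apply: (Rmult_lt_reg_r (Rabs k)) => //.
  have -> : forall x, x / Rabs k * Rabs k = x by move=> x; field; lra.
  apply: Rle_lt_trans X _.
  have -> : eps / (1 + Cmod h) * (Rabs k * Cmod h) =
     eps * Rabs k - eps / (1 + Cmod h) * Rabs k by field; lra.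
  have : 0 < eps / (1 + Cmod h) * Rabs k.
    by apply: Rmult_lt_0_compat => //; apply: Rdiv_lt_0_compat; lra.
  lra.
split; apply/is_derive_Reals => eps /key [d Hd]; exists d => k k0 Hk; apply: Rle_lt_trans (Hd k k0 Hk);
  rewrite /Rdiv -Rabs_inv.
- have -> : (Re (f (z + RtoC (t + k) * h)%C) - Re (f (z + RtoC t * h)%C)) * / k - Re (l * h)%C =
   Re (f (z + RtoC (t + k) * h) - f (z + RtoC t * h) - RtoC k * (l * h))%C * / k.
    by rewrite /Re /=; field.
  by rewrite Rabs_mult; apply: Rmult_le_compat_r; [exact: Rabs_pos | exact: re_le_Cmod].
- have -> : (Im (f (z + RtoC (t + k) * h)%C) - Im (f (z + RtoC t * h)%C)) * / k - Im (l * h)%C =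
   Im (f (z + RtoC (t + k) * h) - f (z + RtoC t * h) - RtoC k * (l * h))%C * / k.
    by rewrite /Im /=; field.
  by rewrite Rabs_mult; apply: Rmult_le_compat_r; [exact: Rabs_pos | exact: im_le_Cmod].
Qed.

(** The mean value theorem has no complex form, so it is applied to the real and imaginary parts
    along the segment; adding the two bounds costs the factor 2. *)
Lemma mean_value_inequality f df z h M :
  (forall t, 0 <= t <= 1 ->
    cderiv f (z + RtoC t * h)%C (df (z + RtoC t * h)%C) /\ Cmod (df (z + RtoC t * h)%C) <= M) ->
  Cmod (f (z + h) - f z)%C <= 2 * M * Cmod h.
Proof.
move=> H.
have component (g dg : R -> R) : (forall t, 0 <= t <= 1 -> is_derive g t (dg t)) ->
    (forall t, 0 <= t <= 1 -> Rabs (dg t) <= M * Cmod h) ->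
    Rabs (g 1 - g 0) <= M * Cmod h.
  move=> D B; have [||c [Hc ->]] := MVT_gen g 0 1 dg.
  - by move=> t; rewrite Rmin_left ?Rmax_right; try lra; move=> Ht; apply: D; lra.
  - move=> t; rewrite Rmin_left ?Rmax_right; try lra; move=> Ht.
    apply/continuity_pt_filterlim.
    apply: (ex_derive_continuous (V := R_NormedModule)).
    by exists (dg t); exact: D.
  - move: Hc; rewrite Rmin_left ?Rmax_right; try lra; move=> Hc.
    by rewrite Rminus_0_r Rmult_1_r; exact: B.
have bound t : 0 <= t <= 1 -> Cmod (df (z + RtoC t * h) * h)%C <= M * Cmod h.
  move=> /H [_ B]; rewrite Cmod_mult; apply: Rmult_le_compat_r => //; exact: Cmod_ge_0.
have [e0 e1] : (z + RtoC 0 * h = z)%C /\ (z + RtoC 1 * h = z + h)%C by split; ring.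
have hr := component (fun t => Re (f (z + RtoC t * h)%C)) (fun t => Re (df (z + RtoC t * h) * h)%C).
have hi := component (fun t => Im (f (z + RtoC t * h)%C)) (fun t => Im (df (z + RtoC t * h) * h)%C).
rewrite /= e0 e1 in hr hi.
apply: Rle_trans (Cmod_le_sum _) _.
have -> : 2 * M * Cmod h = M * Cmod h + M * Cmod h by ring.
apply: Rplus_le_compat; [apply: hr | apply: hi] => t Ht.
- exact: (proj1 (cderiv_line (proj1 (H t Ht)))).
- exact: Rle_trans (re_le_Cmod _) (bound t Ht).
- exact: (proj2 (cderiv_line (proj1 (H t Ht)))).
- exact: Rle_trans (im_le_Cmod _) (bound t Ht).
Qed.

Lemma Cmod_convex a z h t r : Cmod (z - a)%C <= r -> Cmod (z + h - a)%C <= r ->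
  0 <= t <= 1 -> Cmod (z + RtoC t * h - a)%C <= r.
Proof.
move=> H1 H2 Ht.
have -> : (z + RtoC t * h - a = RtoC (1 - t) * (z - a) + RtoC t * (z + h - a))%C.
  by rewrite RtoC_minus; ring.
apply: Rle_trans (Cmod_triangle _ _) _.
rewrite !Cmod_mult !Cmod_R !Rabs_pos_eq; try lra.
have -> : r = (1 - t) * r + t * r by ring.
by apply: Rplus_le_compat; apply: Rmult_le_compat_l; lra.
Qed.

Lemma mean_value_inequality_ball f df a r z w M :
  (forall u, Cmod (u - a)%C <= r -> cderiv f u (df u) /\ Cmod (df u) <= M) ->
  Cmod (z - a)%C <= r -> Cmod (w - a)%C <= r -> Cmod (f w - f z)%C <= 2 * M * Cmod (w - z)%C.
Proof.
move=> H Hz Hw.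
have E : (w = z + (w - z))%C by ring.
rewrite {1}E; apply: mean_value_inequality => t Ht; apply: H.
by apply: Cmod_convex => //; rewrite -E.
Qed.

Lemma lipschitz_continuous (F : R -> R) (L t : R) :
  (forall u, Rabs (F u - F t) <= L * Rabs (u - t)) -> continuous F t.
Proof.
move=> H; apply/continuity_pt_filterlim => eps e0.
have L0 := Rabs_pos L.
exists (eps / (1 + Rabs L)); split; first by apply: Rdiv_lt_0_compat; lra.
move=> u [_ Hu]; rewrite /= /R_dist in Hu *.
apply: Rle_lt_trans (H u) _.
apply: Rle_lt_trans (_ : (1 + Rabs L) * Rabs (u - t) < _).
  by apply: Rmult_le_compat_r; [exact: Rabs_pos | move: (Rle_abs L); lra].
have -> : eps = (1 + Rabs L) * (eps / (1 + Rabs L)) by field; lra.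
by apply: Rmult_lt_compat_l; lra.
Qed.

(** Meant for [df], whose differentiability is still unknown when its circle integral is formed: a
    Lipschitz bound already makes the integrand continuous. *)
Lemma angular_integrable_difference_quotient_lipschitz f z s L :
  (forall w w', Cmod (w - z)%C <= exp s -> Cmod (w' - z)%C <= exp s ->
    Cmod (f w - f w')%C <= L * Cmod (w - w')%C) ->
  angular_integrable (fun t => difference_quotient f z (s, t)).
Proof.
move=> lip.
have on_circle t : Cmod (z + cexp (s, t) - z)%C <= exp s.
  have -> : (z + cexp (s, t) - z = cexp (s, t))%C by ring.
  by rewrite Cmod_cexp; right.
have exp_lip t u : Cmod (cexp (s, u) - cexp (s, t))%C <= 2 * exp s * Rabs (u - t).
  have -> : (s, u) = ((s, t) + (0%coqR, (u - t)%coqR))%C by rewrite /Cplus /=; congr pair; ring.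
  have -> : Rabs (u - t) = Cmod (0%coqR, (u - t)%coqR).
    by rewrite /Cmod /= Rmult_0_l Rplus_0_l Rmult_1_r -/(Rsqr (u - t)) sqrt_Rsqr_abs.
  apply: (mean_value_inequality (df := cexp)) => v _; split; first exact: cderiv_cexp.
  by rewrite Cmod_cexp /=; right; congr exp; ring.
have lip_t t u : Cmod ((f (z + cexp (s, u)) - f z) - (f (z + cexp (s, t)) - f z))%C <=
    Rabs L * (2 * exp s) * Rabs (u - t).
  have -> : ((f (z + cexp (s, u)) - f z) - (f (z + cexp (s, t)) - f z) =
    f (z + cexp (s, u)) - f (z + cexp (s, t)))%C by ring.
  apply: Rle_trans (lip _ _ (on_circle u) (on_circle t)) _.
  have -> : (z + cexp (s, u) - (z + cexp (s, t)) = cexp (s, u) - cexp (s, t))%C by ring.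
  rewrite Rmult_assoc; apply: Rle_trans (_ : Rabs L * Cmod (cexp (s, u) - cexp (s, t))%C <= _).
    by apply: Rmult_le_compat_r; [exact: Cmod_ge_0 | exact: Rle_abs].
  by apply: Rmult_le_compat_l; [exact: Rabs_pos | exact: exp_lip].
have c1 t : continuous (fun u => Re (f (z + cexp (s, u)) - f z)%C) t.
  by apply: lipschitz_continuous => u; apply: Rle_trans (lip_t t u); exact: Re_lipschitz.
have c2 t : continuous (fun u => Im (f (z + cexp (s, u)) - f z)%C) t.
  by apply: lipschitz_continuous => u; apply: Rle_trans (lip_t t u); exact: Im_lipschitz.
have D t : cderiv (fun w => cexp (- w)%C) (s, t) (cexp (- (s, t)) * - (1))%C.
  apply: (cderiv_comp (g := fun w => (- w)%C)); first exact: cderiv_cexp.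
  apply: (cderiv_ext (d := 1) (f := fun w => (- (1) * w)%C)); first exact: Rlt_0_1.
    by move=> w _; ring.
  exact: cderiv_linear.
by split; apply: (ex_RInt_continuous (V := R_CompleteNormedModule)) => t _;
  have [c3 c4] := cderiv_continuous_vertical (D t);
  [apply: (continuous_minus (V := R_NormedModule)) | apply: (continuous_plus (V := R_NormedModule))];
  apply: (continuous_mult (K := R_AbsRing)).
Qed.

(* Cauchy's estimate, applied first to [f], then to its increments, and finally
   to the second-order remainder of [f], bounds [df], shows that it is Lipschitz
   and lets one differentiate the circle formula for [df]. *)
Theorem derivative_holomorphic f df a r : 0 < r ->
  (forall w, Cmod (w - a)%C < r -> cderiv f w (df w)) -> exists m, cderiv df a m.
Proof.
move=> r0 Hf; have pi0 := PI_RGT_0.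
have aa : (a - a = 0)%C by ring.
have [|d1 [d10 Hd1]] := cderiv_continuous (Hf a _) Rlt_0_1; first by rewrite aa Cmod_0.
set d := Rmin r d1.
have d0 : 0 < d by exact: Rmin_pos.
have dr : d <= r by exact: Rmin_l.
have dd : d <= d1 by exact: Rmin_r.
(* All circles have radius d / 8. The estimates hold on balls of radii d / 2, d / 4 and d / 8 about
   a, so that the circles, translates and segments used on one ball stay inside the region
   controlled before. *)
pose s := ln (d / 8).
have es : exp s = d / 8 by apply: exp_ln; lra.
have tri u v w : Cmod (u - w)%C <= Cmod (u - v)%C + Cmod (v - w)%C.
  have -> : (u - w = (u - v) + (v - w))%C by ring.
  exact: Cmod_triangle.
(* Cauchy's estimate with oscillation 2, since f stays within 1 of f(a) at distance less than d. *)
pose M1 := 2 * 2 * exp (- s).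
have bound1 z : Cmod (z - a)%C <= d / 2 -> Cmod (df z) <= M1.
  move=> Hz; apply: (cauchy_estimate (f := f) (z := z)).
  - by move=> w Hw; exists (df w); apply: Hf; move: (tri w z a); lra.
  - by apply: Hf; lra.
  - move=> w Hw.
    have -> : (f w - f z = (f w - f a) + - (f z - f a))%C by ring.
    apply: Rle_trans (Cmod_triangle _ _) _; rewrite Cmod_opp.
    have := Hd1 w ltac:(move: (tri w z a); lra).
    have := Hd1 z ltac:(lra).
    lra.
have lip1 z w : Cmod (z - a)%C <= d / 2 -> Cmod (w - a)%C <= d / 2 ->
    Cmod (f w - f z)%C <= 2 * M1 * Cmod (w - z)%C.
  apply: (mean_value_inequality_ball (df := df)) => u Hu; split; last exact: bound1.
  by apply: Hf; lra.
(* Cauchy's estimate for u |-> f(u + (w - z)) - f(u), whose derivative at z is df w - df z. By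
   [lip1] its values are at most 2 M1 |w - z|, so its oscillation is at most twice that. *)
pose M2 := 2 * (2 * (2 * M1)) * exp (- s).
have lip2 z w : Cmod (z - a)%C <= d / 4 -> Cmod (w - a)%C <= d / 4 ->
    Cmod (df w - df z)%C <= M2 * Cmod (w - z)%C.
  move=> Hz Hw.
  have shifted u : Cmod (u - z)%C <= d / 8 -> Cmod (u + (w - z) - a)%C <= d / 2.
    move=> Hu; have -> : (u + (w - z) - a = (u - z) + (w - a))%C by ring.
    by apply: Rle_trans (Cmod_triangle _ _) _; lra.
  have Dg u : Cmod (u - z)%C <= d / 8 ->
      cderiv (fun u => f (u + (w - z)) - f u)%C u (df (u + (w - z)) - df u)%C.
    move=> Hu; apply: cderiv_plus.
    - have -> : (df (u + (w - z)) = df (u + (w - z)) * (1 + 0))%C by ring.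
      apply: (cderiv_comp (g := fun u => (u + (w - z))%C)).
        by apply: Hf; move: (shifted u Hu); lra.
      exact: cderiv_plus (cderiv_id _) (cderiv_const _ _).
    - have -> : (- df u = 0 * f u + (- (1)) * df u)%C by ring.
      apply: (cderiv_ext (d := 1) (f := fun w => ((- (1)) * f w)%C)); first exact: Rlt_0_1.
        by move=> v _; ring.
      apply: cderiv_mult; first exact: cderiv_const.
      by apply: Hf; move: (tri u z a); lra.
  have zz : (z - z = 0)%C by ring.
  have -> : (df w - df z = df (z + (w - z)) - df z)%C by have -> : (z + (w - z) = w)%C by ring.
  have -> : M2 * Cmod (w - z)%C = 2 * (2 * (2 * M1) * Cmod (w - z)%C) * exp (- s).
    by rewrite /M2; ring.
  apply: (cauchy_estimate (z := z) (f := fun u => (f (u + (w - z)) - f u)%C)).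
  - by move=> u Hu; eexists; apply: Dg; lra.
  - by apply: Dg; rewrite zz Cmod_0; lra.
  - move=> u Hu.
    have -> : (f (u + (w - z)) - f u - (f (z + (w - z)) - f z) =
      (f (u + (w - z)) - f u) + - (f (z + (w - z)) - f z))%C by ring.
    apply: Rle_trans (Cmod_triangle _ _) _; rewrite Cmod_opp.
    have H1 := lip1 u (u + (w - z))%C _ (shifted u _).
    have H2 := lip1 z (z + (w - z))%C _ (shifted z _).
    have {}H1 := H1 ltac:(move: (tri u z a); lra) ltac:(lra).
    have {}H2 := H2 ltac:(lra) ltac:(rewrite zz Cmod_0; lra).
    move: H1 H2.
    have -> : (u + (w - z) - u = w - z)%C by ring.
    have -> : (z + (w - z) - z = w - z)%C by ring.
    lra.
(* This is the increment of u |-> f(u) - df(w) u, whose derivative on the segment is at most M2 |h|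
   by [lip2]; hence a bound quadratic in h. *)
pose rem h w := (f (w + h) - f w - df w * h)%C.
have rem_bound h w : Cmod (w - a)%C <= d / 8 -> Cmod h <= d / 8 ->
    Cmod (rem h w) <= 2 * (M2 * Cmod h) * Cmod h.
  move=> Hw Hh; rewrite /rem.
  have -> : (f (w + h) - f w - df w * h =
    (f (w + h) + (- df w) * (w + h)) - (f w + (- df w) * w))%C by ring.
  have M2p : 0 <= M2.
    have := exp_pos (- s); rewrite /M2 /M1 => e0.
    by do !(apply: Rmult_le_pos; try lra).
  apply: (mean_value_inequality (f := fun u => (f u + (- df w) * u)%C)
            (df := fun u => (df u + - df w)%C)) => t Ht.
  have near : Cmod (w + RtoC t * h - a)%C <= d / 4.
    apply: Cmod_convex => //; first lra.
    have -> : (w + h - a = (w - a) + h)%C by ring.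
    by apply: Rle_trans (Cmod_triangle _ _) _; lra.
  split; first by apply: cderiv_plus; [apply: Hf; lra | exact: cderiv_linear].
  apply: Rle_trans (lip2 w (w + RtoC t * h)%C _ near) _; first lra.
  have -> : (w + RtoC t * h - w = RtoC t * h)%C by ring.
  rewrite Cmod_mult Cmod_R Rabs_pos_eq; last lra.
  apply: Rmult_le_compat_l => //.
  have h0 := Cmod_ge_0 h.
  have : t * Cmod h <= 1 * Cmod h by apply: Rmult_le_compat_r; lra.
  lra.
(* Differentiating 2 pi df(z) = int (f(z + e) - f(z)) / e dt under the integral sign gives [A] as
   candidate for 2 pi times the derivative. The error is the integral of (rem h (a + e) - rem h a) /
   e. *)
pose A := angular_integral (fun t => difference_quotient df a (s, t)).
exists (A / (2 * PI))%C => eps e0.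
(* K |h|^2 bounds two remainders of size 2 M2 |h|^2, divided by the radius. The resulting error is
   at most 2 K |h|^2; in the choice of the radius below, 2 K + 1 is positive from K >= 0 alone. *)
pose K := 4 * M2 * exp (- s).
have K0 : 0 <= K.
  have e1 := exp_pos (- s); rewrite /K /M2 /M1.
  by do !(apply: Rmult_le_pos; try lra).
exists (Rmin (d / 8) (eps / (2 * K + 1))); split.
  by apply: Rmin_pos; [lra | apply: Rdiv_lt_0_compat; lra].
move=> h Hh.
have Hh1 : Cmod h < d / 8 by move: (Rmin_l (d / 8) (eps / (2 * K + 1))); lra.
have Hh2 : Cmod h < eps / (2 * K + 1) by move: (Rmin_r (d / 8) (eps / (2 * K + 1))); lra.
have i1 : angular_integrable (fun t => difference_quotient df a (s, t)).
  apply: (angular_integrable_difference_quotient_lipschitz (L := M2)) => w w' Hw Hw'.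
  by apply: lip2; lra.
have i2 : angular_integrable (fun t => difference_quotient f a (s, t)).
  by apply: angular_integrable_difference_quotient => w Hw; exists (df w); apply: Hf; lra.
have aha : (a + h - a = h)%C by ring.
have near_ah w : Cmod (w - (a + h))%C <= exp s -> Cmod (w - a)%C < r.
  by move=> Hw; have := tri w (a + h)%C a; rewrite aha; lra.
have i3 : angular_integrable (fun t => difference_quotient f (a + h)%C (s, t)).
  by apply: angular_integrable_difference_quotient => w Hw; exists (df w);
    apply: Hf; apply: near_ah; lra.
have F1 : angular_integral (fun t => difference_quotient f a (s, t)) = (2 * PI * df a)%C.
  apply: circle_formula; last by apply: Hf; rewrite aa Cmod_0.
  by move=> w Hw; exists (df w); apply: Hf; lra.
have F2 : angular_integral (fun t => difference_quotient f (a + h)%C (s, t)) = (2 * PI * df (a + h))%C.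
  apply: circle_formula; last by apply: Hf; rewrite aha; lra.
  by move=> w Hw; exists (df w); apply: Hf; exact: near_ah.
have [i4 F3] := angular_integral_sub 1%C i3 i2.
have [i5 F4] := angular_integral_sub h i4 i1.
have piC : RtoC PI <> 0%C by move=> [E]; lra.
have two : RtoC 2 <> 0%C by move=> [E]; lra.
have E : (2 * PI * (df (a + h) - df a - A / (2 * PI) * h) =
   angular_integral (fun t => difference_quotient f (a + h)%C (s, t) - 1 * difference_quotient f a (s, t)
     - h * difference_quotient df a (s, t)))%C.
  by rewrite F4 F3 F1 F2 -/A; field.
have B := angular_integral_bound (M := K * Cmod h * Cmod h) i5.
rewrite -E Cmod_2PI in B.
have {}B : Cmod (df (a + h) - df a - A / (2 * PI) * h)%C <= 2 * (K * Cmod h * Cmod h).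
  apply: (Rmult_le_reg_l (2 * PI)); first lra.
  have -> : 2 * PI * (2 * (K * Cmod h * Cmod h)) = 4 * PI * (K * Cmod h * Cmod h) by ring.
  apply: B => t; rewrite /difference_quotient.
  set e := cexp (s, t).
  have -> : ((f (a + h + e) - f (a + h)) * cexp (- (s, t)) - 1 * ((f (a + e) - f a) * cexp (- (s, t)))
     - h * ((df (a + e) - df a) * cexp (- (s, t))) =
     (rem h (a + e)%C - rem h a) * cexp (- (s, t)))%C.
    rewrite /rem; have -> : (a + h + e = a + e + h)%C by ring.
    by ring.
  rewrite Cmod_mult Cmod_cexp /=.
  have -> : K * Cmod h * Cmod h = (2 * (M2 * Cmod h) * Cmod h + 2 * (M2 * Cmod h) * Cmod h) * exp (- s).
    by rewrite /K; ring.
  apply: Rmult_le_compat_r; first by apply: Rlt_le; exact: exp_pos.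
  apply: Rle_trans (Cmod_triangle _ _) _; rewrite Cmod_opp.
  apply: Rplus_le_compat; apply: rem_bound; try lra.
  - have -> : (a + e - a = e)%C by ring.
    by rewrite /e Cmod_cexp /=; lra.
  - by rewrite aa Cmod_0; lra.
apply: Rle_trans B _.
have h0 := Cmod_ge_0 h.
have -> : 2 * (K * Cmod h * Cmod h) = 2 * K * Cmod h * Cmod h by ring.
apply: Rmult_le_compat_r => //.
apply: Rle_trans (_ : (2 * K + 1) * (eps / (2 * K + 1)) <= _); last by right; field; lra.
apply: Rle_trans (_ : (2 * K + 1) * Cmod h <= _); first lra.
by apply: Rmult_le_compat_l; lra.
Qed.

End DerivativeHolomorphic.

(** * Products of harmonic functions of z with polynomials in t, and their smoothness *)

Section Waves.
Local Set Implicit Arguments.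
Local Unset Strict Implicit.
Local Open Scope R_scope.

Lemma holomorphic_cderiv f z : holomorphic_on_disc f -> H2 z -> cderiv f z (C_derive f z).
Proof. by move=> H /H Hz; apply/is_derive_cderiv; apply: C_derive_correct. Qed.

Lemma cderiv_holomorphic f df : (forall z, H2 z -> cderiv f z (df z)) -> holomorphic_on_disc f.
Proof. by move=> H z /H Hz; exists (df z); apply/is_derive_cderiv. Qed.

Lemma holomorphic_derive f : holomorphic_on_disc f -> holomorphic_on_disc (C_derive f).
Proof.
move=> Hf z Hz.
have [||m Hm] := @derivative_holomorphic f (C_derive f) z (1 - Cmod z).
- by rewrite /H2 in Hz; lra.
- move=> w Hw; apply: holomorphic_cderiv => //; rewrite /H2.
  have -> : w = (w - z + z)%C by ring.
  by apply: Rle_lt_trans (Cmod_triangle _ _) _; lra.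
- by exists m; apply/is_derive_cderiv.
Qed.

Lemma holomorphic_scal c f : holomorphic_on_disc f -> holomorphic_on_disc (fun w => c * f w)%C.
Proof.
move=> Hf; apply: (@cderiv_holomorphic _ (fun z => 0 * f z + c * C_derive f z)%C) => z Hz.
by apply: cderiv_mult; [exact: cderiv_const | exact: holomorphic_cderiv].
Qed.

Lemma C_derive_scal c f z : holomorphic_on_disc f -> H2 z ->
  C_derive (fun w => c * f w)%C z = (c * C_derive f z)%C.
Proof.
move=> Hf Hz; apply: is_C_derive_unique; apply/is_derive_cderiv.
have := cderiv_mult (cderiv_const c z) (holomorphic_cderiv Hf Hz).
by have -> : (0 * f z + c * C_derive f z = c * C_derive f z)%C by ring.
Qed.

Lemma H2_conj z : H2 z -> H2 (Cconj z).
Proof. by rewrite /H2 Cmod_conj. Qed.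

Lemma is_derive_horner (p : {poly R}) (t : R) :
  is_derive (fun h => p.[t + h]%R) 0 (p^`().[t])%R.
Proof.
elim/poly_ind: p => [|p c IH].
  rewrite deriv0 horner0; apply: (is_derive_ext (fun _ => 0)); last exact: is_derive_const.
  by move=> h; rewrite horner0.
apply: (is_derive_ext (fun h => p.[t + h]%R * (t + h) + c)).
  by move=> h; rewrite hornerMXaddC.
rewrite derivMXaddC hornerD hornerMX.
have D : is_derive (fun h => t + h) 0 1.
  by have := is_derive_plus (fun _ => t) id 0 0 1 (is_derive_const t 0) (is_derive_id 0);
    rewrite /plus /= Rplus_0_l.
have := is_derive_plus _ (fun _ => c) _ _ _ (is_derive_mult _ _ _ _ _ IH D Rmult_comm) (is_derive_const c 0).
rewrite /plus /mult /zero /= !Rplus_0_r Rmult_1_r.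
have -> : p.[t + 0%coqR]%R = p.[t]%R by congr horner; exact: Rplus_0_r.
by rewrite Rplus_comm.
Qed.

(** A convertible form of [shift] with the addition of the standard library, the one that the lemmas
    on [R] and [C] mention. *)
Lemma shiftE (i : 'I_3) (a b t h : R) : shift i ((a, b), t) h =
  match nat_of_ord i with
  | 0%nat => (((a + h)%coqR, b), t)
  | 1%nat => ((a, (b + h)%coqR), t)
  | _ => ((a, b), (t + h)%coqR)
  end.
Proof. by []. Qed.

(** The complex polynomial p + i q is kept as a pair of real ones. Imaginary parts are covered too,
    since Im v = Re (-i v) and -i (p + i q) = q - i p. *)
Definition wave (f g : C -> C) (p q : {poly R}) (x : C * R) : R :=
  Re ((f x.1 + g (Cconj x.1)) * (p.[x.2]%R, q.[x.2]%R))%C.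

(** The complex increment of z that corresponds to a unit step in x or in y. *)
Definition direction (i : 'I_3) : C := if nat_of_ord i is 0%nat then 1%C else Ci.

(** The conjugate of z + h k is conj z + h conj k: both summands are holomorphic functions along a
    line, and the derivative picks up the factor k on f' and conj k on g'. *)
Lemma is_derive_wave_horizontal f g p q (i : 'I_3) x : holomorphic_on_disc f -> holomorphic_on_disc g ->
  H2xR x -> (i < 2)%N ->
  is_derive (fun h => wave f g p q (shift i x h)) 0
    (wave (fun w => direction i * C_derive f w)%C
          (fun w => Cconj (direction i) * C_derive g w)%C p q x).
Proof.
case: x => z t Hf Hg; rewrite /H2xR /= => Hz Hi.
pose c : C := (p.[t]%R, q.[t]%R).
set k := direction i.
have E h : shift i (z, t) h = ((z + RtoC h * k)%C, t).
  rewrite /k /direction; case: z {Hz} => a b; rewrite shiftE.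
  by case: i Hi {k} => [[|[|[|?]]] Hi] //= _; rewrite /Cplus /Cmult /=; congr pair; congr pair; ring.
have zk : (z + 0 * k = z)%C by ring.
have zk' : (Cconj z + 0 * Cconj k = Cconj z)%C by ring.
have D F w l : cderiv F w l -> cderiv (fun v => F v * c)%C w (l * c)%C.
  move=> H; have := cderiv_mult H (cderiv_const c w).
  by have -> : (l * c + F w * 0 = l * c)%C by ring.
have [D1 _] : _ /\ _ := cderiv_line (z := z) (t := 0) (h := k) (D f _ _ (holomorphic_cderiv Hf (eq_ind_r H2 Hz zk))).
have [D2 _] : _ /\ _ := cderiv_line (z := Cconj z) (t := 0) (h := Cconj k)
  (D g _ _ (holomorphic_cderiv Hg (eq_ind_r H2 (H2_conj Hz) zk'))).
rewrite zk in D1; rewrite zk' in D2.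
have := is_derive_plus _ _ _ _ _ D1 D2.
have -> : plus (Re (C_derive f z * c * k)%C) (Re (C_derive g (Cconj z) * c * Cconj k)%C) =
  wave (fun w => k * C_derive f w)%C (fun w => Cconj k * C_derive g w)%C p q (z, t).
  by rewrite /wave /= -/c /plus /Re /=; ring.
apply: is_derive_ext => h; rewrite -[RHS]/(wave f g p q (shift i (z, t) h)) E /wave /= -/c.
have -> : Cconj (z + RtoC h * k) = (Cconj z + RtoC h * Cconj k)%C.
  by rewrite Cplus_conj Cmult_conj; congr (_ + _ * _)%C; rewrite /Cconj /= Ropp_0.
by rewrite /plus /Re /=; ring.
Qed.

Lemma is_derive_wave_vertical f g p q (i : 'I_3) x : (1 < i)%N ->
  is_derive (fun h => wave f g p q (shift i x h)) 0 (wave f g p^`() q^`() x).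
Proof.
case: x => [z t] Hi; rewrite /wave /=.
set H := (f z + g (Cconj z))%C.
have D1 := is_derive_scal _ _ (Re H) _ (is_derive_horner p t).
have D2 := is_derive_scal _ _ (Im H) _ (is_derive_horner q t).
apply: is_derive_ext (is_derive_minus _ _ _ _ _ D1 D2) => h.
by rewrite /shift; case: z @H D1 D2 => a b H _ _; case: i Hi => [[|[|[|?]]] Hi].
Qed.

Lemma H2xR_shift (x : C * R) (i : 'I_3) : H2xR x -> locally 0 (fun h => H2xR (shift i x h)).
Proof.
case: x => [[a b] t] Hz; rewrite /H2xR /H2 /= in Hz.
have d0 : 0 < 1 - Cmod (a, b) by lra.
exists (mkposreal _ d0) => h Hh.
have {}Hh : Rabs h < 1 - Cmod (a, b).
  move: Hh; rewrite /ball /= /AbsRing_ball /abs /= /minus /plus /opp /=.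
  by rewrite Ropp_0 Rplus_0_r.
rewrite /H2xR /H2 shiftE; case: i => [[|[|[|?]]] ?] //=.
- have -> : ((a + h)%coqR, b) = ((a, b) + RtoC h)%C by rewrite /Cplus /= Rplus_0_r.
  by apply: Rle_lt_trans (Cmod_triangle _ _) _; rewrite Cmod_R; lra.
- have -> : (a, (b + h)%coqR) = ((a, b) + RtoC h * Ci)%C.
    by rewrite /Cplus /=; congr pair; ring.
  by apply: Rle_lt_trans (Cmod_triangle _ _) _; rewrite Cmod_mult Cmod_Ci Cmod_R; lra.
Qed.

Lemma H2xR_open (x : C * R) : H2xR x -> locally x H2xR.
Proof.
case: x => [[a b] t]; rewrite /H2xR /H2 /= => Hz.
have d0 : 0 < (1 - Cmod (a, b)) / 2 by lra.
exists (mkposreal _ d0) => [[[a' b'] t']] [[/= Ha Hb] _] /=.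
have {}Ha : Rabs (a' - a) < (1 - Cmod (a, b)) / 2 by exact: Ha.
have {}Hb : Rabs (b' - b) < (1 - Cmod (a, b)) / 2 by exact: Hb.
have -> : (a', b') = ((a, b) + ((a' - a)%coqR, (b' - b)%coqR))%C.
  by rewrite /Cplus /=; congr pair; ring.
apply: Rle_lt_trans (Cmod_triangle _ _) _.
by have := Cmod_le_sum ((a' - a)%coqR, (b' - b)%coqR); rewrite /=; lra.
Qed.

Lemma partial_ext u v i x : H2xR x -> (forall y, H2xR y -> u y = v y) ->
  partial i u x = partial i v x.
Proof.
move=> Hx E; apply: Derive_ext_loc.
by apply: filter_imp (H2xR_shift i Hx) => h; exact: E.
Qed.

Lemma partial_wave_horizontal f g p q (i : 'I_3) x : holomorphic_on_disc f -> holomorphic_on_disc g ->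
  H2xR x -> (i < 2)%N ->
  partial i (wave f g p q) x =
  wave (fun w => direction i * C_derive f w)%C
       (fun w => Cconj (direction i) * C_derive g w)%C p q x.
Proof. by move=> Hf Hg Hx Hi; apply: is_derive_unique; exact: is_derive_wave_horizontal. Qed.

Lemma partial_wave_vertical f g p q (i : 'I_3) x : (1 < i)%N ->
  partial i (wave f g p q) x = wave f g p^`() q^`() x.
Proof. by move=> Hi; apply: is_derive_unique; exact: is_derive_wave_vertical. Qed.

(** Continuity refers here to the product structure on pairs, whose balls are squares; the radius d
    / 2 places a square inside the disc of radius d. *)
Lemma continuous_cderiv f z l : cderiv f z l ->
  continuous (fun w : C_UniformSpace => Re (f w)) z /\
  continuous (fun w : C_UniformSpace => Im (f w)) z.
Proof.
move=> /cderiv_continuous H.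
have near eps : 0 < eps -> locally (z : C_UniformSpace) (fun w => Cmod (f w - f z)%C < eps).
  move=> /H [d [d0 Hd]].
  have d20 : 0 < d / 2 by lra.
  exists (mkposreal _ d20) => w [/= Ha Hb]; apply: Hd.
  have {}Ha : Rabs (w.1 - z.1) < d / 2 by exact: Ha.
  have {}Hb : Rabs (w.2 - z.2) < d / 2 by exact: Hb.
  by apply: Rle_lt_trans (Cmod_le_sum _) _; rewrite /Re /Im /= -/(Rminus _ _) -/(Rminus w.2 _); lra.
split; apply/filterlim_locally => eps; apply: filter_imp (near _ (cond_pos eps)) => w Hw.
- exact: Rle_lt_trans (Re_lipschitz _ _) Hw.
- exact: Rle_lt_trans (Im_lipschitz _ _) Hw.
Qed.

Lemma continuous_wave f g p q (x : C * R) : holomorphic_on_disc f -> holomorphic_on_disc g ->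
  H2xR x -> continuous (wave f g p q) x.
Proof.
case: x => z t Hf Hg Hx; rewrite /H2xR /= in Hx.
have cf := continuous_cderiv (holomorphic_cderiv Hf Hx).
have cg := continuous_cderiv (holomorphic_cderiv Hg (H2_conj Hx)).
have cconj : continuous (Cconj : C_UniformSpace -> C_UniformSpace) z.
  apply/filterlim_locally => eps; exists eps => w [Ha Hb]; split => //=.
  rewrite /ball /= /AbsRing_ball /abs /= /minus /plus /opp /=.
  have -> : - w.2 + - - z.2 = - (w.2 - z.2) by ring.
  by rewrite Rabs_Ropp; exact: Hb.
have cpoly (r : {poly R}) : continuous (fun y : C * R => r.[y.2]%R) (z, t).
  apply: (continuous_comp (fun y : C * R => y.2) (fun s : R => r.[s]%R)); first exact: continuous_snd.
  (* Derivatives are taken in the increment h at 0, so continuity at t is recovered by composing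
     with s |-> s - t. *)
  have := ex_derive_continuous (V := R_NormedModule) (fun h => r.[t + h]%R) 0
    (ex_intro _ _ (is_derive_horner r t)).
  move=> H0; apply: (continuous_ext (fun s => (fun h => r.[t + h]%R) (s - t))).
    by move=> s; congr (horner _ _); exact: Rplus_minus.
  apply: (continuous_comp (fun s => s - t) (fun h => r.[t + h]%R)).
    by apply: (continuous_minus (V := R_NormedModule)); [exact: continuous_id | exact: continuous_const].
  by rewrite Rminus_diag.
have cF (F : C -> R) : continuous (F : C_UniformSpace -> R_UniformSpace) z ->
    continuous (fun y : C * R => F y.1) (z, t).
  by move=> cF; apply: (continuous_comp (fun y : C * R => y.1) F) => //; exact: continuous_fst.
have cG (F : C -> R) : continuous (F : C_UniformSpace -> R_UniformSpace) (Cconj z) ->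
    continuous (fun y : C * R => F (Cconj y.1)) (z, t).
  by move=> cG; apply: (cF (fun w => F (Cconj w))); exact: (continuous_comp Cconj F).
apply: (continuous_minus (V := R_NormedModule)); apply: (continuous_mult (K := R_AbsRing));
  try exact: cpoly; apply: (continuous_plus (V := R_NormedModule)).
- exact: cF (proj1 cf).
- exact: cG (proj1 cg).
- exact: cF (proj2 cf).
- exact: cG (proj2 cg).
Qed.

(** The invariant for iterated partial derivatives: each [partial] changes the four witnesses but
    not the shape. Equality is asked on the domain only, where derivatives are computed. *)
Definition is_wave (u : C * R -> R) : Prop := exists f g p q,
  [/\ holomorphic_on_disc f, holomorphic_on_disc g & forall x, H2xR x -> u x = wave f g p q x].

Lemma is_wave_partial u i : is_wave u ->
  is_wave (partial i u) /\ forall x, H2xR x -> ex_partial i u x.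
Proof.
move=> [f [g [p [q [Hf Hg E]]]]].
have key f' g' p' q' : holomorphic_on_disc f' -> holomorphic_on_disc g' ->
    (forall x, H2xR x -> is_derive (fun h => wave f g p q (shift i x h)) 0 (wave f' g' p' q' x)) ->
    is_wave (partial i u) /\ forall x, H2xR x -> ex_partial i u x.
  move=> Hf' Hg' D.
  have Du x : H2xR x -> is_derive (fun h => u (shift i x h)) 0 (wave f' g' p' q' x).
    move=> Hx; apply: is_derive_ext_loc (D x Hx).
    by apply: filter_imp (H2xR_shift i Hx) => h Hh; rewrite E.
  split; last by move=> x Hx; exists (wave f' g' p' q' x); exact: Du.
  by exists f', g', p', q'; split=> // x Hx; apply: is_derive_unique; exact: Du.
have [Hi|Hi] := ltnP i 2.
- apply: key; last by move=> x Hx; exact: is_derive_wave_horizontal.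
  + exact: holomorphic_scal (holomorphic_derive Hf).
  + exact: holomorphic_scal (holomorphic_derive Hg).
- by apply: (key f g) => // x Hx; exact: is_derive_wave_vertical.
Qed.

Lemma is_wave_smooth u : is_wave u -> smooth_real u.
Proof.
move=> Hu s x Hx.
have W : is_wave (iter_partial s u).
  by elim: s => //= i s IH; exact: (is_wave_partial i IH).1.
split; last by move=> i; exact: (is_wave_partial i W).2.
case: W => [f [g [p [q [Hf Hg E]]]]].
apply: (continuous_ext_loc _ (wave f g p q)); last exact: continuous_wave.
by apply: filter_imp (H2xR_open Hx) => y Hy; rewrite E.
Qed.

End Waves.

(** * The Laplace-Beltrami operator and its iterates on these products *)

Section Laplacian.
Local Set Implicit Arguments.
Local Unset Strict Implicit.
Local Open Scope R_scope.

Definition conformal_factor (z : C) : R := (4 / (1 - Cmod z ^+ 2) ^+ 2)%R.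

Lemma conformal_factor_gt0 z : H2 z -> 0 < conformal_factor z.
Proof.
move=> /RltP Hz; apply/RltP; apply: Num.Theory.divr_gt0; first exact: Num.Theory.ltr0n.
apply: Num.Theory.exprn_gt0; rewrite Num.Theory.subr_gt0 Num.Theory.expr_lt1 //.
by apply/RleP; exact: Cmod_ge_0.
Qed.

Lemma product_metricE x :
  product_metric x = @block_mx R 2 1 2 1 ((conformal_factor x.1)%:M)%R 0%R 0%R (1%:M)%R.
Proof. by []. Qed.

Lemma det_product_metric x : sqrt (\det (product_metric x))%R = Rabs (conformal_factor x.1).
Proof.
rewrite product_metricE (@det_ublock R 2 1) !det_scalar GRing.expr1n GRing.mulr1 GRing.expr2.
exact: sqrt_Rsqr_abs.
Qed.

Lemma invmx_product_metric x : H2xR x -> invmx (product_metric x) =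
  @block_mx R 2 1 2 1 ((/ conformal_factor x.1)%:M)%R 0%R 0%R (1%:M)%R.
Proof.
move=> /conformal_factor_gt0 Hx; rewrite product_metricE.
set A := block_mx _ _ _ _; set B := block_mx _ _ _ _.
have AB : (A *m B = 1%:M)%R.
  rewrite (@mulmx_block R 2 1 2 1 2 1) !mulmx0 !mul0mx !GRing.addr0 !GRing.add0r mulmx1.
  rewrite -scalar_mxM; have -> : (conformal_factor x.1 * / conformal_factor x.1)%R = 1%R.
    by apply: Rinv_r; lra.
  by rewrite -(@scalar_mx_block R 2 1).
have [Au _] := mulmx1_unit AB.
by rewrite -[LHS]mulmx1 -AB mulmxA mulVmx // mul1mx.
Qed.

Lemma block_diag_mxE (c : R) (i j : 'I_(2 + 1)) :
  @block_mx R 2 1 2 1 (c%:M)%R 0%R 0%R (1%:M)%R i j =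
  if i == j then (if (i < 2)%N then c else 1%R) else 0%R.
Proof.
case: (split_ordP i) => i' ->; case: (split_ordP j) => j' ->.
- by rewrite block_mxEul !mxE eq_lshift; case: eqP.
- by rewrite block_mxEur !mxE eq_lrshift.
- by rewrite block_mxEdl !mxE eq_rlshift.
- by rewrite block_mxEdr !mxE eq_rshift; case: eqP.
Qed.

(** Conformal invariance in dimension 2: |G|^(1/2) is the conformal factor itself, which cancels the
    inverse metric on x and y and survives only on t. *)
Lemma product_metric_gradient u (i : 'I_3) x : H2xR x ->
  (sqrt (\det (product_metric x)) * \sum_(j < 3) invmx (product_metric x) i j * partial j u x)%R =
  if (i < 2)%N then partial i u x else conformal_factor x.1 * partial i u x.
Proof.
move=> Hx; have l0 := conformal_factor_gt0 Hx.
rewrite det_product_metric (invmx_product_metric Hx) Rabs_pos_eq; last lra.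
rewrite (bigD1 i) //= big1; last first.
  by move=> j ji; rewrite block_diag_mxE eq_sym (negbTE ji) GRing.mul0r.
rewrite block_diag_mxE eqxx GRing.addr0; case: ifP => _; last by rewrite GRing.mul1r.
rewrite GRing.mulrA; have -> : (conformal_factor x.1 * / conformal_factor x.1)%R = 1%R.
  by apply: Rinv_r; lra.
by rewrite GRing.mul1r.
Qed.

Lemma partial_partial_wave_horizontal f g p q (i : 'I_3) x :
  holomorphic_on_disc f -> holomorphic_on_disc g -> H2xR x -> (i < 2)%N ->
  partial i (partial i (wave f g p q)) x =
  wave (fun w => direction i * direction i * C_derive (C_derive f) w)%C
       (fun w => Cconj (direction i * direction i) * C_derive (C_derive g) w)%C p q x.
Proof.
move=> Hf Hg Hx Hi.
have Hf' := holomorphic_derive Hf; have Hg' := holomorphic_derive Hg.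
rewrite (partial_ext i Hx (fun y Hy => partial_wave_horizontal p q Hf Hg Hy Hi)).
rewrite partial_wave_horizontal //; try exact: holomorphic_scal.
rewrite /wave C_derive_scal // C_derive_scal //; last exact: H2_conj.
by rewrite Cmult_conj !Cmult_assoc.
Qed.

(** The conformal factor left on the t-term is divided out by |G|^(-1/2). [u] is only assumed to
    agree with a wave on the domain, the form in which one application of [tau] feeds the next. *)
Lemma laplace_beltrami_wave u f g p q x :
  holomorphic_on_disc f -> holomorphic_on_disc g ->
  (forall y, H2xR y -> u y = wave f g p q y) -> H2xR x ->
  laplace_beltrami product_metric u x = wave f g p^`(2)%R q^`(2)%R x.
Proof.
move=> Hf Hg E Hx; have l0 := conformal_factor_gt0 Hx.
rewrite /laplace_beltrami det_product_metric Rabs_pos_eq; last lra.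
have Epart i y : H2xR y -> partial i u y = partial i (wave f g p q) y.
  by move=> Hy; exact: partial_ext.
have horizontal (i : 'I_3) : (i < 2)%N -> partial i (fun y =>
     (sqrt (\det (product_metric y)) * \sum_(j < 3) invmx (product_metric y) i j * partial j u y)%R) x =
     partial i (partial i (wave f g p q)) x.
  move=> Hi; apply: partial_ext => // y Hy.
  by rewrite product_metric_gradient // Hi Epart.
have vertical (i : 'I_3) : (1 < i)%N -> partial i (fun y =>
     (sqrt (\det (product_metric y)) * \sum_(j < 3) invmx (product_metric y) i j * partial j u y)%R) x =
     conformal_factor x.1 * wave f g p^`(2)%R q^`(2)%R x.
  move=> Hi.
  rewrite (partial_ext (v := fun y => conformal_factor y.1 * wave f g p^`()%R q^`()%R y) i Hx); last first.
    move=> y Hy; rewrite product_metric_gradient // ltnNge Hi /= Epart //.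
    by rewrite partial_wave_vertical.
  rewrite -[p^`(2)%R]/(p^`()^`())%R -[q^`(2)%R]/(q^`()^`())%R.
  (* The conformal factor depends on z alone, which a shift in t leaves fixed, so it can be taken
     out of the derivative. *)
  rewrite -(partial_wave_vertical f g p^`()%R q^`()%R x Hi) /partial -Derive_scal.
  apply: Derive_ext => h; congr (_ * _).
  by clear -Hi; case: x => [[a b] t]; case: i Hi => [[|[|[|?]]] ?].
rewrite !big_ord_recl big_ord0 (horizontal ord0) // (horizontal (lift ord0 ord0)) //.
rewrite (vertical (lift ord0 (lift ord0 ord0))) //.
rewrite !partial_partial_wave_horizontal // GRing.addr0.
set W := wave f g _ _ x.
(* The squares of the two directions are 1 and -1, and so are their conjugates. *)
have cancel : wave (fun w => direction ord0 * direction ord0 * C_derive (C_derive f) w)%C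
       (fun w => Cconj (direction ord0 * direction ord0) * C_derive (C_derive g) w)%C p q x
  + (wave (fun w => direction (lift ord0 ord0) * direction (lift ord0 ord0) * C_derive (C_derive f) w)%C
       (fun w => Cconj (direction (lift ord0 ord0) * direction (lift ord0 ord0)) * C_derive (C_derive g) w)%C p q x
  + conformal_factor x.1 * W) = conformal_factor x.1 * W.
  rewrite /wave /direction /= /Re /=; ring.
apply: etrans (congr1 (Rmult (/ conformal_factor x.1)) cancel) _.
by field; lra.
Qed.

Lemma sum_n_horner (b : nat -> C) (n : nat) (t : R) :
  sum_n (fun k => b k * RtoC t ^ k)%C n =
  ((\poly_(k < n.+1) Re (b k)).[t]%R, (\poly_(k < n.+1) Im (b k)).[t]%R).
Proof.
rewrite !horner_poly; elim: n => [|n IH].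
  rewrite sum_O !big_ord_recl !big_ord0 /= !GRing.addr0 !GRing.expr0 !GRing.mulr1 Cmult_1_r.
  by rewrite -surjective_pairing.
have mulR (z : C) (u : R) : (z * RtoC u)%C = ((Re z * u)%coqR, (Im z * u)%coqR).
  by apply: injective_projections; rewrite /Re /Im /=; ring.
by rewrite sum_Sn IH !(big_ord_recr n.+1) -RtoC_pow mulR RpowE.
Qed.

Lemma Im_wave f g (p q : {poly R}) (y : C * R) :
  Im ((f y.1 + g (Cconj y.1)) * (p.[y.2]%R, q.[y.2]%R))%C = wave f g q (- p)%R y.
Proof.
rewrite /wave; have -> : (- p).[y.2]%R = - p.[y.2]%R :> R by exact: hornerN.
by rewrite /Re /Im /=; ring.
Qed.

(** [tau] acts on the components separately: the real part is the wave of (p, q), the imaginary part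
    that of (q, -p), and their images reassemble into one complex product. *)
Lemma iter_tau_wave F f g p q n x :
  holomorphic_on_disc f -> holomorphic_on_disc g ->
  (forall y, H2xR y -> F y = ((f y.1 + g (Cconj y.1)) * (p.[y.2]%R, q.[y.2]%R))%C) ->
  H2xR x ->
  iter n tau F x =
  ((f x.1 + g (Cconj x.1)) * ((p^`(2 * n)).[x.2]%R, (q^`(2 * n)).[x.2]%R))%C.
Proof.
move=> Hf Hg EF; elim: n x => [|n IH] x Hx; first exact: EF.
rewrite iterS /tau (@laplace_beltrami_wave _ f g (p^`(2 * n))%R (q^`(2 * n))%R) //; last first.
  by move=> y Hy; rewrite IH.
rewrite (@laplace_beltrami_wave _ f g (q^`(2 * n))%R (- p^`(2 * n))%R) //; last first.
  by move=> y Hy; rewrite IH // Im_wave.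
have D (s : {poly R}) : (s^`(2 * n)^`(2))%R = (s^`(2 * n.+1))%R.
  by rewrite mulnSr addnC.
by rewrite derivnN !D -Im_wave.
Qed.

(** The naturals below [size p] are distinct roots, as many as the size, one more than a nonzero p
    can have. *)
Lemma poly_eq0_of_horner (p : {poly R}) : (forall t : R, p.[t]%R = 0%R) -> p = 0%R.
Proof.
move=> p0; apply: (@roots_geq_poly_eq0 R p [seq (k%:R)%R | k <- seq.iota 0%N (size p)]).
- by apply/allP => t _; rewrite rootE p0.
- rewrite map_inj_uniq ?iota_uniq // => m n /eqP.
  by rewrite Num.Theory.eqr_nat => /eqP.
- by rewrite size_map size_iota.
Qed.

End Laplacian.

(** Properness fails for F = 0, which occurs when f(z) and g(conj z) cancel, for instance for
    opposite constants; [fg_neq0] rules this out. *)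
Theorem lemma6p1 (r : nat) (f g : C -> C) (b : nat -> C) (P : R -> C)
    (r_gt0 : (0 < r)%N)
    (f_holo : holomorphic_on_disc f)
    (g_holo : holomorphic_on_disc g)
    (P_def : forall t : R,
       P t = sum_n (fun k => (b k * RtoC t ^ k)%C) (2 * r - 1)%N)
    (b_neq0 : (b (2 * r - 2)%N, b (2 * r - 1)%N) <> (RtoC 0, RtoC 0))
    (fg_neq0 : exists z : C, H2 z /\ (f z + g (Cconj z))%C <> RtoC 0) :
  proper_r_harmonic r (fun p : C * R => ((f p.1 + g (Cconj p.1)) * P p.2)%C).
Proof.
pose p : {poly R} := (\poly_(k < 2 * r) Re (b k))%R.
pose q : {poly R} := (\poly_(k < 2 * r) Im (b k))%R.
have PE t : P t = (p.[t]%R, q.[t]%R).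
  by rewrite P_def sum_n_horner subn1 prednK // muln_gt0.
have EF y : H2xR y -> ((f y.1 + g (Cconj y.1)) * P y.2)%C =
    ((f y.1 + g (Cconj y.1)) * (p.[y.2]%R, q.[y.2]%R))%C by rewrite PE.
split; first split.
- split; apply: is_wave_smooth.
  + by exists f, g, p, q; split=> // y Hy; rewrite EF.
  + by exists f, g, q, (- p)%R; split=> // y Hy; rewrite EF // Im_wave.
- move=> y Hy; rewrite (iter_tau_wave r f_holo g_holo EF Hy) !derivn_poly0 ?size_poly //.
  by rewrite !horner0 -[(_, _)]/(RtoC 0) Cmult_0_r.
(* On the line over this z the factor f(z) + g(conj z) can be divided out, so the derivatives of
   order 2r - 2 of both real polynomials vanish at every t. *)
- case: fg_neq0 => z [Hz nz] V; apply: b_neq0.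
  (* Subtraction on naturals is truncated; 0 < r makes these index identities true. *)
  have E2r : (2 * r = (2 * r - 2).+2)%N by case: (r) r_gt0 => // r' _; rewrite mulnS addKn.
  have E2r1 : (2 * r - 1 = (2 * r - 2).+1)%N by case: (r) r_gt0 => // r' _; rewrite mulnS addKn.
  have zero t : (p^`(2 * r - 2)).[t]%R = 0%coqR /\ (q^`(2 * r - 2)).[t]%R = 0%coqR.
    have := V (z, t) Hz; rewrite (iter_tau_wave r.-1 f_holo g_holo EF) //=.
    have -> : (2 * r.-1 = 2 * r - 2)%N by rewrite -subn1 mulnBr muln1.
    move=> E.
    have [] : ((p^`(2 * r - 2)).[t]%R, (q^`(2 * r - 2)).[t]%R) = RtoC 0.
      by have := f_equal (Cmult (/ (f z + g (Cconj z)))) E; rewrite Cmult_assoc Cinv_l // Cmult_1_l Cmult_0_r.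
    by [].
  have lin (c : nat -> R) : (forall t, ((\poly_(k < 2 * r) c k)^`(2 * r - 2)).[t]%R = 0%coqR) ->
      c (2 * r - 2)%N = 0%coqR /\ c (2 * r - 1)%N = 0%coqR.
    set s := (\poly_(k < _) _)%R => Hs.
    have s0 := poly_eq0_of_horner Hs.
    have coef k : (k < 2)%N -> c (2 * r - 2 + k)%N = 0%R.
      move=> k2; have := congr1 (fun u : {poly R} => u`_k)%R s0.
      have lt_2r : (2 * r - 2 + k < 2 * r)%N.
        by rewrite [X in (_ < X)%N]E2r -(addn2 (2 * r - 2)) ltn_add2l.
      rewrite coef_derivn coef0 coef_poly lt_2r.
      (* The k-th coefficient of the derivative is c (2r - 2 + k) times a falling factorial, which
         is nonzero, so c (2r - 2 + k) itself vanishes. *)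
      move/eqP; rewrite Num.Theory.mulrn_eq0 -leqn0 leqNgt ffact_gt0 leq_addr /=.
      by move/eqP.
    by split; [have := coef 0%N isT; rewrite addn0 | have := coef 1%N isT; rewrite addn1 -E2r1].
  have [p0 p1] := lin _ (fun t => (zero t).1).
  have [q0 q1] := lin _ (fun t => (zero t).2).
  by congr pair; apply: injective_projections.
Qed.
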